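(* Let $d\ge2$ be an integer and let $p,n$ be real with $p\ge n>d/2$. The sharp constant $K_{pn}$ has the bound $$K_{pn}\le K^{\langle+\rangle}_{pn},\qquad K^{\langle+\rangle}_{pn}:=\frac{2^{p+1}}{(2\pi)^{d/2}}\sqrt{\zeta_{2n}},\qquad\zeta_{2n}:=\sum_{h\in\mathbf Z^d\setminus\{0\}}\frac1{|h|^{2n}}$$ (and $(K^{\langle+\rangle}_{pn})^{1/p}\to2$ for fixed $d,n$ and $p\to+\infty$).
   Context: Notation. $\mathbf T^d=(\mathbf R/2\pi\mathbf Z)^d$; $e_k(x)=(2\pi)^{-d/2}e^{ik\cdot x}$ for $k\in\mathbf Z^d$; $a\cdot b=\sum_ra_rb_r$ and $|a|=\sqrt{\overline a\cdot a}$ on $\mathbf C^d$; $\mathbf Z^d_0=\mathbf Z^d\setminus\{0\}$. An $\mathbf R^d$-valued distribution on $\mathbf T^d$ has a Fourier expansion $v=\sum_kv_ke_k$, $v_k=\overline{v_{-k}}\in\mathbf C^d$. For real $m$, $\mathbb H^m$ is the space of such $v$ with $k\cdot v_k=0$ for all $k$, $v_0=0$ and $\|v\|_m^2:=\sum_{k\in\mathbf Z^d_0}|k|^{2m}|v_k|^2<\infty$. The Leray projection $\mathfrak L$ acts by $(\mathfrak Lv)_k=v_k-\frac{k\cdot v_k}{|k|^2}k$ for $k\ne0$, $(\mathfrak Lv)_0=v_0$. $\mathcal P(v,w)=\mathfrak L(v\cdot\partial w)$, $(v\cdot\partial w)_s=\sum_{r=1}^dv_r\partial_rw_s$; for $p>d/2$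 it maps $\mathbb H^p\times\mathbb H^{p+1}$ to $\mathbb H^p$. For $p\ge n>d/2$, $K_{pn}$ is the sharp (i.e. minimum) constant $K$ such that $\|\mathcal P(v,w)\|_p\le\frac12K(\|v\|_p\|w\|_{n+1}+\|v\|_n\|w\|_{p+1})$ for all $v\in\mathbb H^p$, $w\in\mathbb H^{p+1}$ (such constants exist). *)

(* Defs.v *)
From HB Require Import structures.
From mathcomp Require Import all_boot all_order all_algebra.
From mathcomp Require Import complex.
From mathcomp Require Import all_classical all_reals all_analysis.

Set Implicit Arguments.
Unset Strict Implicit.
Unset Printing Implicit Defensive.

Import Order.TTheory GRing.Theory Num.Theory.
Import numFieldNormedType.Exports.

Local Open Scope classical_set_scope.
Local Open Scope ring_scope.
Local Open Scope complex_scope.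

Section Vectors.
Context {R : realType} {d : nat}.
Implicit Types a b : 'rV[R[i]]_d.

(* bilinear, without conjugation *)
Definition cdot a b : R[i] := \sum_(r < d) a ord0 r * b ord0 r.

Definition conjv a : 'rV[R[i]]_d := map_mx (@conjc R) a.

Definition enorm a : R := Num.sqrt (complex.Re (cdot (conjv a) a)).

Definition zvec (k : 'rV[int]_d) : 'rV[R[i]]_d := map_mx (fun z : int => z%:~R) k.

Definition znorm (k : 'rV[int]_d) : R := enorm (zvec k).

End Vectors.

Section Torus.
Context {R : realType}.

(* Unconditional sums over an arbitrary index type; meaningful for absolutely
   summable families. *)
Definition rsum (I : choiceType) (f : I -> R) : R :=
  fine (\esum_(i in [set: I]) (Num.max (f i) 0)%:E)
  - fine (\esum_(i in [set: I]) (Num.max (- f i) 0)%:E).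

Definition csum (I : choiceType) (f : I -> R[i]) : R[i] :=
  rsum (fun i => complex.Re (f i)) +i* rsum (fun i => complex.Im (f i)).

(* Integral over [0, 2 pi]^d, as an iterated Lebesgue integral (by Fubini it is
   the d-dimensional integral when f is continuous). *)
Fixpoint torus_rint (d : nat) : ('rV[R]_d -> R) -> R :=
  match d with
  | 0 => fun f => f 0
  | d'.+1 => fun f =>
      \int[lebesgue_measure]_(t in `[0, 2 * pi])
        torus_rint (fun y : 'rV[R]_d' => f (row_mx (t%:M : 'rV[R]_1) y))
  end.

Definition torus_int (d : nat) (f : 'rV[R]_d -> R[i]) : R[i] :=
  torus_rint (fun x => complex.Re (f x)) +i* torus_rint (fun x => complex.Im (f x)).

(* Functions on the torus are 2 pi-periodic functions on R^d. *)
Definition fourier_mode (d : nat) (k : 'rV[int]_d) (x : 'rV[R]_d) : R[i] :=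
  let t := \sum_(r < d) (k ord0 r)%:~R * x ord0 r in
  (((2 * pi) `^ (d%:R / 2))^-1)%:C * (cos t +i* sin t).

Definition fourier_coef (d : nat) (f : 'rV[R]_d -> R[i]) (k : 'rV[int]_d) : R[i] :=
  torus_int (fun x => fourier_mode (- k) x * f x).

Definition fourier_sum (d : nat) (c : 'rV[int]_d -> R[i]) (x : 'rV[R]_d) : R[i] :=
  csum (fun k => c k * fourier_mode k x).

End Torus.

Section Distributions.
Context {R : realType} {d : nat}.

(* A C^d-valued distribution on the torus is identified with the family of its
   Fourier coefficients; the families that arise in this way are those of at
   most polynomial growth. *)
Definition coefs := 'rV[int]_d -> 'rV[R[i]]_d.

Implicit Types v w : coefs.

Definition real_distribution v : Prop :=
  (exists (C : R) (N : nat), forall k, enorm (v k) <= C * (1 + znorm k) ^+ N)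
  /\ (forall k, v k = conjv (v (- k))).

(* Extended-real valued: +oo when the series diverges, so that the inequality in
   [admissible] below includes the finiteness of its left-hand side. *)
Definition hnorm (m : R) v : \bar R :=
  sqrte (\esum_(k in [set k : 'rV[int]_d | k != 0])
           (znorm k `^ (2 * m) * enorm (v k) ^+ 2)%:E).

Definition in_H (m : R) v : Prop :=
  [/\ real_distribution v,
      forall k, cdot (zvec k) (v k) = 0,
      v 0 = 0 &
      (hnorm m v < +oo)%E].

Definition leray v : coefs := fun k =>
  if k == 0 then v k
  else v k - (cdot (zvec k) (v k) / (znorm k ^+ 2)%:C) *: zvec k.

Definition vcomp v (s : 'I_d) : 'rV[int]_d -> R[i] := fun k => v k ord0 s.

(* Distributional derivative: the mode e_k is multiplied by i k_r. *)
Definition partial (r : 'I_d) (c : 'rV[int]_d -> R[i]) : 'rV[int]_d -> R[i] :=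
  fun k => (0 +i* (k ord0 r)%:~R) * c k.

(* The product is the pointwise product of the functions defined by the Fourier
   series of v_r and of d_r w_s, which converge absolutely when v is in H^p and
   w in H^(p+1) with p > d/2. *)
Definition advection v w : coefs := fun k =>
  \row_s fourier_coef
    (fun x => \sum_(r < d)
       fourier_sum (vcomp v r) x * fourier_sum (partial r (vcomp w s)) x) k.

Definition calP v w : coefs := leray (advection v w).

End Distributions.

Arguments coefs : clear implicits.

Section Constants.
Context {R : realType}.

Definition admissible (d : nat) (p n K : R) : Prop :=
  forall v w : coefs R d, in_H p v -> in_H (p + 1) w ->
    (hnorm p (calP v w) <=
       (2^-1 * K)%:E *
         (hnorm p v * hnorm (n + 1) w + hnorm n v * hnorm (p + 1) w))%E.

Definition is_sharp_constant (d : nat) (p n K : R) : Prop :=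
  admissible d p n K /\ (forall K', admissible d p n K' -> K <= K').

Definition zeta (d : nat) (s : R) : R :=
  fine (\esum_(h in [set h : 'rV[int]_d | h != 0]) ((znorm h `^ s)^-1)%:E).

Definition Kplus (d : nat) (p n : R) : R :=
  2 `^ (p + 1) / (2 * pi) `^ (d%:R / 2) * Num.sqrt (zeta d (2 * n)).

End Constants.

(* Main.v *)
Require Import Defs.
From mathcomp Require Import all_boot all_order all_algebra.
From mathcomp Require Import complex ring lra.
From mathcomp Require Import all_classical all_reals all_analysis.
From mathcomp Require Import measurable_realfun.
Import Order.TTheory GRing.Theory Num.Theory.
Import numFieldNormedType.Exports.
Local Open Scope classical_set_scope.
Local Open Scope ring_scope.

(** The theorem is a convolution estimate on the Fourier side.  Write c for
    (2 pi)^(-d/2).  Since all the series involved converge absolutely, the k-th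
    coefficient of v . grad w is c times the sum over h of i (v_h . (k - h))
    w_(k-h), the Leray projection does not increase the modulus of a
    coefficient, and so the k-th coefficient of P(v, w) is at most
      c sum_h |v_h| |k - h| |w_(k-h)|.
    Multiply by |k|^p and use |k|^p <= 2^p (|h|^p + |k - h|^p), which follows
    from |k| <= 2 max(|h|, |k - h|) ([znorm_powR_split]).  This leaves two
    convolutions, one of a square-summable family with a summable one and one
    the other way round; by Young's inequality ([convolution_l2_l1],
    [convolution_l1_l2]) their l2 norms are at most |v|_p sum |l||w_l| and
    (sum |v_h|) |w|_(p+1).  Cauchy-Schwarz against the weight |k|^(-n) bounds
    the two l1 norms by sqrt(zeta_2n) |w|_(n+1) and sqrt(zeta_2n) |v|_n
    ([sums_le_weighted_zeta]), and the product of the constants is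
    K / 2 with K = 2^(p+1) c sqrt(zeta_2n) ([Kplus_admissible]).

    Infinite sums enter only through limits.  The estimate is proved for finite
    sums, uniformly in the finite set of summation, and every infinite object
    is approximated: a Fourier series is the limit of its partial sums along an
    enumeration of the lattice ([rsum_exhaust]), the Fourier coefficient of a
    product of two absolutely convergent series is the limit of the
    coefficients of the products of partial sums ([fourier_coef_product_cvg],
    by dominated convergence, one variable at a time), and the bound passes to
    the limit in any finite sum over k, hence to the norm ([hnorm_calP_le]).

    That zeta_2n is finite for 2n > d is seen by comparing |k|^(-2n) with a
    product over the d coordinates of one-dimensional weights of exponent
    2n/d > 1 ([inv_znorm_powR_le]).

    A sharp constant exists because the admissible constants form a closed set
    that is bounded below by 0: some nonzero field lies in every H^m, as d >= 2
    ([exists_in_H]).  Finally K has the form 2^p a with a > 0 independent of p,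
    and a^(1/p) tends to 1. *)

Set Implicit Arguments.
Unset Strict Implicit.
Unset Printing Implicit Defensive.

Local Notation normc := Normc.normc.

(** * Finite sums *)

Section FiniteSums.
Context {R : rcfType}.

Lemma ler_of_sqr (x y : R) : 0 <= y -> x ^+ 2 <= y ^+ 2 -> x <= y.
Proof. by move=> y0 /(ler_wsqrtr); rewrite !sqrtr_sqr (ger0_norm y0); exact/le_trans/ler_norm. Qed.

Lemma sum_CauchySchwarz (I : Type) (s : seq I) (a b : I -> R) :
  (\sum_(i <- s) a i * b i) ^+ 2 <=
  (\sum_(i <- s) a i ^+ 2) * (\sum_(i <- s) b i ^+ 2).
Proof.
elim: s => [|i s IH]; first by rewrite !big_nil expr0n /= mulr0.
rewrite !big_cons; set x := \sum_(_ <- _) _ in IH *.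
set A := \sum_(_ <- _) _ in IH *; set B := \sum_(_ <- _) _ in IH *.
have A0 : 0 <= A by apply: sumr_ge0 => j _; exact: sqr_ge0.
have B0 : 0 <= B by apply: sumr_ge0 => j _; exact: sqr_ge0.
(* AM-GM on the cross term, using the induction hypothesis x^2 <= A B. *)
have : 2 * (x * (a i * b i)) <= A * b i ^+ 2 + B * a i ^+ 2.
  apply: ler_of_sqr; first by rewrite addr_ge0 // mulr_ge0 ?sqr_ge0.
  have h1 := sqr_ge0 (A * b i ^+ 2 - B * a i ^+ 2).
  have h2 : x ^+ 2 * (a i * b i) ^+ 2 <= A * B * (a i * b i) ^+ 2.
    by rewrite ler_wpM2r ?sqr_ge0.
  rewrite -subr_ge0 in h2; rewrite -subr_ge0.
  have -> : (A * b i ^+ 2 + B * a i ^+ 2) ^+ 2 - (2 * (x * (a i * b i))) ^+ 2 =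
    (A * b i ^+ 2 - B * a i ^+ 2) ^+ 2 +
    4 * (A * B * (a i * b i) ^+ 2 - x ^+ 2 * (a i * b i) ^+ 2) by ring.
  by rewrite addr_ge0 // mulr_ge0.
rewrite -subr_ge0 => h; rewrite -subr_ge0 in IH; rewrite -subr_ge0.
have -> : (a i ^+ 2 + A) * (b i ^+ 2 + B) - (a i * b i + x) ^+ 2 =
  (A * B - x ^+ 2) + (A * b i ^+ 2 + B * a i ^+ 2 - 2 * (x * (a i * b i))) by ring.
exact: addr_ge0.
Qed.

Lemma sum_CauchySchwarz_le (I : Type) (s : seq I) (a b : I -> R) (A B : R) :
  0 <= A -> 0 <= B ->
  \sum_(i <- s) a i ^+ 2 <= A ^+ 2 -> \sum_(i <- s) b i ^+ 2 <= B ^+ 2 ->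
  \sum_(i <- s) a i * b i <= A * B.
Proof.
move=> A0 B0 hA hB; apply: ler_of_sqr; first exact: mulr_ge0.
apply: le_trans (sum_CauchySchwarz _ _ _) _.
by rewrite exprMn ler_pM // sumr_ge0 // => i _; exact: sqr_ge0.
Qed.

Lemma sum_Minkowski_le (I : Type) (s : seq I) (a b : I -> R) (A B : R) :
  0 <= A -> 0 <= B ->
  \sum_(i <- s) a i ^+ 2 <= A ^+ 2 -> \sum_(i <- s) b i ^+ 2 <= B ^+ 2 ->
  \sum_(i <- s) (a i + b i) ^+ 2 <= (A + B) ^+ 2.
Proof.
move=> A0 B0 hA hB; have h := sum_CauchySchwarz_le A0 B0 hA hB.
have -> : \sum_(i <- s) (a i + b i) ^+ 2 =
   \sum_(i <- s) a i ^+ 2 + (\sum_(i <- s) a i * b i) *+ 2 + \sum_(i <- s) b i ^+ 2.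
  by rewrite -sumrMnl -!big_split /=; apply: eq_bigr => i _; rewrite sqrrD.
by rewrite sqrrD lerD // lerD // lerMn2r.
Qed.

(** Cauchy-Schwarz applied to the factors sqrt b and a sqrt b. *)
Lemma sum_weighted_CauchySchwarz (I : Type) (s : seq I) (a b : I -> R) :
  (forall i, 0 <= b i) ->
  (\sum_(i <- s) a i * b i) ^+ 2 <=
  (\sum_(i <- s) b i) * (\sum_(i <- s) a i ^+ 2 * b i).
Proof.
move=> b0; have := sum_CauchySchwarz s (fun i => Num.sqrt (b i)) (fun i => a i * Num.sqrt (b i)).
under eq_bigr do rewrite mulrCA -expr2 sqr_sqrtr //.
under [in X in _ <= X * _]eq_bigr do rewrite sqr_sqrtr //.
by under [in X in _ <= _ * X]eq_bigr do rewrite exprMn sqr_sqrtr //.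
Qed.

End FiniteSums.

(** For a nonnegative family this is summability over T with sum at most B,
    phrased without infinite sums. *)
Definition sums_le {R : numDomainType} {T : eqType} (f : T -> R) (B : R) :=
  forall s : seq T, uniq s -> \sum_(i <- s) f i <= B.

Section Convolution.
Context {R : rcfType} {G : zmodType}.
Implicit Types (a b : G -> R) (s F : seq G).

Lemma sums_le_shift (b : G -> R) B s h :
  sums_le b B -> uniq s -> \sum_(k <- s) b (k - h) <= B.
Proof.
move=> bB us; rewrite -(big_map (fun k => k - h) xpredT b); apply: bB.
by rewrite map_inj_uniq //; exact: addIr.
Qed.

Lemma sums_le_reflect (b : G -> R) B s k :
  sums_le b B -> uniq s -> \sum_(h <- s) b (k - h) <= B.
Proof.
move=> bB us; rewrite -(big_map (fun h => k - h) xpredT b); apply: bB.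
by rewrite map_inj_uniq // => x y /addrI /oppr_inj.
Qed.

(** Young's inequality for l2 * l1: by Cauchy-Schwarz with weight b, the square
    of the inner sum is at most B times the sum of a^2 b, and summing that over
    k first costs another factor B. *)
Lemma convolution_l2_l1 a b (A B : R) F s :
  uniq F -> uniq s -> (forall h, 0 <= b h) -> 
  sums_le (fun h => a h ^+ 2) (A ^+ 2) -> sums_le b B ->
  \sum_(k <- s) (\sum_(h <- F) a h * b (k - h)) ^+ 2 <= (A * B) ^+ 2.
Proof.
move=> uF us b0 aA bB.
have B0 : 0 <= B by have := bB [::] isT; rewrite big_nil.
have -> : (A * B) ^+ 2 = B * (B * A ^+ 2) by ring.
apply: (@le_trans _ _ (\sum_(k <- s) B * \sum_(h <- F) a h ^+ 2 * b (k - h))).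
  apply: ler_sum => k _.
  apply: le_trans (sum_weighted_CauchySchwarz _ _ (fun h => b0 (k - h))) _.
  apply: ler_wpM2r; last exact: sums_le_reflect.
  by apply: sumr_ge0 => h _; rewrite mulr_ge0 ?sqr_ge0.
rewrite -mulr_sumr ler_wpM2l // exchange_big /=.
apply: (@le_trans _ _ (\sum_(h <- F) a h ^+ 2 * B)).
  apply: ler_sum => h _; rewrite -mulr_sumr ler_wpM2l ?sqr_ge0 //.
  exact: sums_le_shift.
by rewrite -mulr_suml mulrC ler_wpM2l ?aA.
Qed.

(** The mirror image: here the first factor is the weight. *)
Lemma convolution_l1_l2 a b (A B : R) F s :
  uniq F -> uniq s -> (forall h, 0 <= a h) -> 
  sums_le a A -> sums_le (fun h => b h ^+ 2) (B ^+ 2) ->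
  \sum_(k <- s) (\sum_(h <- F) a h * b (k - h)) ^+ 2 <= (A * B) ^+ 2.
Proof.
move=> uF us a0 aA bB.
have A0 : 0 <= A by have := aA [::] isT; rewrite big_nil.
have -> : (A * B) ^+ 2 = A * (A * B ^+ 2) by ring.
apply: (@le_trans _ _ (\sum_(k <- s) A * \sum_(h <- F) b (k - h) ^+ 2 * a h)).
  apply: ler_sum => k _; under eq_bigr do rewrite mulrC.
  apply: le_trans (sum_weighted_CauchySchwarz _ _ a0) _.
  apply: ler_wpM2r; last exact: aA.
  by apply: sumr_ge0 => h _; rewrite mulr_ge0 ?sqr_ge0.
rewrite -mulr_sumr ler_wpM2l // exchange_big /=.
apply: (@le_trans _ _ (\sum_(h <- F) a h * B ^+ 2)).
  apply: ler_sum => h _; rewrite -mulr_suml mulrC ler_wpM2l //.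
  exact: (sums_le_shift (b := fun h => b h ^+ 2)).
by rewrite -mulr_suml ler_wpM2r ?sqr_ge0 ?aA.
Qed.

End Convolution.

(** * Unconditional sums as limits of finite sums *)

Section SumsOverSets.
Context {R : realType} {T : choiceType}.

Lemma esum_le_sums (S : set T) (f : T -> R) (B : R) :
  (forall s, uniq s -> (forall i, i \in s -> S i) -> \sum_(i <- s) f i <= B) ->
  (\esum_(i in S) (f i)%:E <= B%:E)%E.
Proof.
move=> h; apply: ge_ereal_sup => _ [X [finX XS] <-].
rewrite fsbig_finite //= sumEFin lee_fin; apply: h; first exact: finmap.fset_uniq.
by move=> i; rewrite in_fset_set // inE => /XS.
Qed.

Lemma sums_le_esum (S : set T) (f : T -> R) (s : seq T) :
  uniq s -> (forall i, i \in s -> S i) ->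
  ((\sum_(i <- s) f i)%:E <= \esum_(i in S) (f i)%:E)%E.
Proof.
move=> us sS; apply: esum_ge; exists [set` s].
  by split; [exact: finite_seq | move=> i /sS].
by rewrite -fsbig_seq //= sumEFin.
Qed.

End SumsOverSets.

Section Exhaustion.
Context {T : countType}.

(** A fixed increasing sequence of finite sets with union T, along which all
    unconditional sums are evaluated. *)
Definition exhaust (N : nat) : seq T := undup (pmap unpickle (iota 0 N)).

Lemma exhaust_uniq N : uniq (exhaust N).
Proof. exact: undup_uniq. Qed.

Lemma mem_exhaust (x : T) N : (pickle x < N)%N -> x \in exhaust N.
Proof.
move=> xN; rewrite mem_undup mem_pmap; apply/mapP; exists (pickle x).
  by rewrite mem_iota.
by rewrite pickleK.
Qed.

Lemma subset_exhaust (s : seq T) : \forall N \near \oo, {subset s <= exhaust N}.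
Proof.
exists (\sum_(x <- s) (pickle x).+1)%N => // N /= hN x xs.
by apply: mem_exhaust; apply: leq_trans hN; rewrite (big_rem x xs) /= leq_addr.
Qed.

End Exhaustion.

Lemma ler_sum_subset (R : numDomainType) (T : eqType) (f : T -> R) (s t : seq T) :
  uniq s -> {subset s <= t} -> (forall i, 0 <= f i) ->
  \sum_(i <- s) f i <= \sum_(i <- t) f i.
Proof.
move=> us; elim: s us t => [|x s IH] /= us t st f0.
  by rewrite big_nil sumr_ge0.
case/andP: us => xs us; rewrite big_cons.
have xt : x \in t by apply: st; rewrite inE eqxx.
rewrite (big_rem x xt) /= lerD2l; apply: IH => // y ys.
have yx : y != x by apply: contraNneq xs => <-.
have := st y; rewrite inE ys orbT => /(_ isT).
by rewrite (perm_mem (perm_to_rem xt)) inE (negbTE yx).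
Qed.

Section UnconditionalSums.
Context {R : realType} {T : countType}.

(** The partial sums stay below the supremum L, and some finite X comes within
    e of it; the exhaustion contains X from some point on. *)
Lemma esum_exhaust (f : T -> R) (B : R) :
  (forall i, 0 <= f i) -> sums_le f B ->
  (\sum_(i <- exhaust N) f i) @[N --> \oo] --> fine (\esum_(i in [set: T]) (f i)%:E).
Proof.
move=> f0 fB; set L := (\esum_(i in _) _)%E.
have LB : (L <= B%:E)%E by apply: esum_le_sums => s us _; exact: fB.
have L0 : (0 <= L)%E by apply: esum_ge0 => i _; rewrite lee_fin.
have Lfin : L \is a fin_num by rewrite ge0_fin_numE // (le_lt_trans LB) // ltry.
apply/cvgrPdist_le => e e0.
have : ((fine L - e)%:E < L)%E by rewrite -{2}(fineK Lfin) lte_fin ltrBlDr ltrDl.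
move=> /ereal_sup_gt[_ [X [finX _] <-]].
rewrite fsbig_finite //= sumEFin lte_fin => hX.
near=> N.
have h1 : \sum_(i <- finmap.enum_fset (fset_set X)) f i <= \sum_(i <- exhaust N) f i.
  by apply: ler_sum_subset => //; near: N; exact: subset_exhaust.
have h2 : \sum_(i <- exhaust N) f i <= fine L.
  by rewrite -lee_fin fineK //; apply: sums_le_esum => //; exact: exhaust_uniq.
by rewrite ger0_norm ?subr_ge0 // lerBlDr -lerBlDl; apply: ltW; exact: lt_le_trans h1.
Unshelve. all: by end_near. Qed.

(** Absolute convergence makes both the positive and the negative part of the
    sum finite, so that their difference is a genuine limit. *)
Lemma rsum_exhaust (f g : T -> R) (B : R) :
  (forall i, `|f i| <= g i) -> sums_le g B ->
  (\sum_(i <- exhaust N) f i) @[N --> \oo] --> rsum f.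
Proof.
move=> fg gB.
have pB (h : T -> R) : (forall i, h i <= g i) -> sums_le (fun i => Num.max (h i) 0) B.
  move=> hg s us; apply: le_trans (gB s us); apply: ler_sum => i _.
  by rewrite ge_max hg (le_trans _ (fg i)).
have max0 (h : T -> R) i : 0 <= Num.max (h i) 0 by rewrite le_max lexx orbT.
have -> : (fun N => \sum_(i <- exhaust N) f i) =
   (fun N => \sum_(i <- exhaust N) Num.max (f i) 0 - \sum_(i <- exhaust N) Num.max (- f i) 0).
  apply/funext => N; rewrite -sumrB; apply: eq_bigr => i _.
  have [h|/ltW h] := leP (f i) 0.
    by rewrite max_l ?oppr_ge0 // sub0r opprK.
  by rewrite max_r ?subr0 // oppr_le0.
apply: cvgB; apply: esum_exhaust; try exact: max0; apply: pB => i.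
  exact: le_trans (ler_norm _) (fg i).
by apply: le_trans (ler_norm _) _; rewrite normrN.
Qed.

End UnconditionalSums.

(** * Complex vectors and lattice vectors *)

Section ComplexModulus.
Context {R : realType}.
Implicit Types x y z : R[i].

Lemma normc_sqr z : normc z ^+ 2 = complex.Re z ^+ 2 + complex.Im z ^+ 2.
Proof. by case: z => a b /=; rewrite sqr_sqrtr // addr_ge0 ?sqr_ge0. Qed.

Lemma normc_ge0 z : 0 <= normc z.
Proof. by case: z => a b /=; exact: sqrtr_ge0. Qed.

Lemma normr_Re_le z : `|complex.Re z| <= normc z.
Proof.
apply: ler_of_sqr; first exact: normc_ge0.
by rewrite normc_sqr real_normK ?num_real // lerDl sqr_ge0.
Qed.

Lemma normr_Im_le z : `|complex.Im z| <= normc z.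
Proof.
apply: ler_of_sqr; first exact: normc_ge0.
by rewrite normc_sqr real_normK ?num_real // lerDr sqr_ge0.
Qed.

Lemma ReD x y : complex.Re (x + y) = complex.Re x + complex.Re y.
Proof. by case: x y => [a b] [c d]. Qed.

Lemma ImD x y : complex.Im (x + y) = complex.Im x + complex.Im y.
Proof. by case: x y => [a b] [c d]. Qed.

Lemma ReM x y : complex.Re (x * y) =
  complex.Re x * complex.Re y - complex.Im x * complex.Im y.
Proof. by case: x y => [a b] [c d]. Qed.

Lemma ImM x y : complex.Im (x * y) =
  complex.Re x * complex.Im y + complex.Im x * complex.Re y.
Proof. by case: x y => [a b] [c d] /=. Qed.

Lemma Re_sum (I : Type) (s : seq I) (P : pred I) (f : I -> R[i]) :
  complex.Re (\sum_(i <- s | P i) f i) = \sum_(i <- s | P i) complex.Re (f i).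
Proof. exact: (big_morph _ ReD erefl). Qed.

Lemma Im_sum (I : Type) (s : seq I) (P : pred I) (f : I -> R[i]) :
  complex.Im (\sum_(i <- s | P i) f i) = \sum_(i <- s | P i) complex.Im (f i).
Proof. exact: (big_morph _ ImD erefl). Qed.

Lemma normc_sum (I : Type) (s : seq I) (P : pred I) (f : I -> R[i]) :
  normc (\sum_(i <- s | P i) f i) <= \sum_(i <- s | P i) normc (f i).
Proof.
elim/big_ind2: _ => [|x1 x2 y1 y2 h1 h2|//].
  by rewrite [normc _]Normc.normc0.
by apply: le_trans (le_normcD _ _) _; exact: lerD.
Qed.

End ComplexModulus.

Section Vectors.
Context {R : realType} {d : nat}.
Implicit Types a b : 'rV[R[i]]_d.

Lemma enorm_ge0 a : 0 <= enorm a.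
Proof. exact: sqrtr_ge0. Qed.

Lemma enorm_sqr a : enorm a ^+ 2 = \sum_(r < d) normc (a ord0 r) ^+ 2.
Proof.
have e : complex.Re (cdot (conjv a) a) = \sum_(r < d) normc (a ord0 r) ^+ 2.
  rewrite Re_sum; apply: eq_bigr => r _; rewrite mxE normc_sqr.
  by case: (a ord0 r) => x y /=; rewrite mulNr opprK !expr2.
by rewrite /enorm sqr_sqrtr e // sumr_ge0 // => r _; exact: sqr_ge0.
Qed.

Lemma enorm_eq_of_sqr a x : 0 <= x -> enorm a ^+ 2 = x ^+ 2 -> enorm a = x.
Proof. by move=> x0 /eqP; rewrite eqrXn2 ?enorm_ge0 // => /eqP. Qed.

Lemma normc_le_enorm a r : normc (a ord0 r) <= enorm a.
Proof.
apply: ler_of_sqr; first exact: enorm_ge0.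
by rewrite enorm_sqr (bigD1 r) //= lerDl sumr_ge0 // => j _; exact: sqr_ge0.
Qed.

Lemma normc_cdot a b : normc (cdot a b) <= enorm a * enorm b.
Proof.
apply: le_trans (normc_sum _ _ _) _.
under eq_bigr do rewrite Normc.normcM.
by apply: sum_CauchySchwarz_le; rewrite ?enorm_ge0 // enorm_sqr.
Qed.

Lemma enorm0 : enorm (0 : 'rV[R[i]]_d) = 0.
Proof.
apply: enorm_eq_of_sqr => //; rewrite enorm_sqr expr0n /= big1 // => r _.
by rewrite mxE [normc _]Normc.normc0 expr0n.
Qed.

Lemma enormD a b : enorm (a + b) <= enorm a + enorm b.
Proof.
apply: ler_of_sqr; first by rewrite addr_ge0 ?enorm_ge0.
rewrite enorm_sqr; apply: (@le_trans _ _ (\sum_(r < d) (normc (a ord0 r) + normc (b ord0 r)) ^+ 2)).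
  apply: ler_sum => r _; rewrite mxE ler_pXn2r ?nnegrE ?addr_ge0 ?normc_ge0 //.
  exact: le_normcD.
by apply: sum_Minkowski_le; rewrite ?enorm_ge0 // enorm_sqr.
Qed.

Lemma enormZ z a : enorm (z *: a) = normc z * enorm a.
Proof.
apply: enorm_eq_of_sqr; first by rewrite mulr_ge0 ?normc_ge0 ?enorm_ge0.
rewrite exprMn !enorm_sqr mulr_sumr; apply: eq_bigr => r _.
by rewrite mxE Normc.normcM exprMn.
Qed.

Lemma enorm_sum (I : Type) (s : seq I) (f : I -> 'rV[R[i]]_d) :
  enorm (\sum_(i <- s) f i) <= \sum_(i <- s) enorm (f i).
Proof.
elim/big_ind2: _ => [|x1 x2 y1 y2 h1 h2|//]; first by rewrite enorm0.
by apply: le_trans (enormD _ _) _; exact: lerD.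
Qed.

End Vectors.

Section Lattice.
Local Open Scope complex_scope.
Context {R : realType} {d : nat}.
Implicit Types (h k l : 'rV[int]_d) (v : coefs R d).
Local Notation znorm := (@znorm R d).

Lemma znorm_ge0 k : 0 <= znorm k.
Proof. exact: enorm_ge0. Qed.

Lemma Re_intr (m : int) : complex.Re (m%:~R : R[i]) = m%:~R.
Proof. by rewrite -(rmorph_int (real_complex R)). Qed.

Lemma Im_intr (m : int) : complex.Im (m%:~R : R[i]) = 0.
Proof. by rewrite -(rmorph_int (real_complex R)). Qed.

Lemma znorm_sqr k : znorm k ^+ 2 = \sum_(r < d) (k ord0 r)%:~R ^+ 2.
Proof.
rewrite enorm_sqr; apply: eq_bigr => r _.
by rewrite mxE normc_sqr Re_intr Im_intr expr0n addr0.
Qed.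

Lemma znormD h l : znorm (h + l) <= znorm h + znorm l.
Proof.
rewrite /znorm; have -> : zvec (h + l) = zvec h + zvec l :> 'rV[R[i]]_d.
  by apply/rowP => r; rewrite !mxE intrD.
exact: enormD.
Qed.

Lemma znorm0 : znorm 0 = 0.
Proof.
apply: enorm_eq_of_sqr => //; rewrite -/(znorm 0) znorm_sqr expr0n big1 // => r _.
by rewrite mxE expr0n.
Qed.

Lemma normr_coord_le_znorm k r : `|(k ord0 r)%:~R| <= znorm k.
Proof.
apply: ler_of_sqr; first exact: znorm_ge0.
rewrite znorm_sqr real_normK ?num_real // (bigD1 r) //= lerDl sumr_ge0 // => j _.
exact: sqr_ge0.
Qed.

(** Some coordinate of k is a nonzero integer.  This is what makes the norms of
    H^m increase with m. *)
Lemma znorm_ge1 k : k != 0 -> 1 <= znorm k.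
Proof.
move=> k0; have [r kr] : exists r, k ord0 r != 0.
  apply/existsP; apply: contraNT k0; rewrite negb_exists => /forallP h.
  by apply/eqP/rowP => r; rewrite mxE; apply/eqP; have := h r; rewrite negbK.
apply: le_trans (normr_coord_le_znorm k r).
rewrite -intr_norm ler1z; by case: (k ord0 r) kr => [[|m]|m].
Qed.

(** The projection is orthogonal: it subtracts |k . v_k|^2 / |k|^2 from
    |v_k|^2.  As k is real, the computation splits into the real and the
    imaginary part, with S and T the real and imaginary parts of k . v_k. *)
Lemma enorm_leray v k : enorm (leray v k) <= enorm (v k).
Proof.
rewrite /leray; case: eqP => // /eqP k0.
have kn : 0 < znorm k by apply: lt_le_trans (znorm_ge1 k0).
apply: ler_of_sqr; first exact: enorm_ge0.
set c := _ / _; rewrite !enorm_sqr.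
pose S := \sum_(r < d) ((k ord0 r)%:~R * complex.Re (v k ord0 r)).
pose T := \sum_(r < d) ((k ord0 r)%:~R * complex.Im (v k ord0 r)).
have cd : cdot (zvec k) (v k) = S +i* T.
  apply/eqP; rewrite eq_complex; apply/andP; split; apply/eqP.
    rewrite Re_sum; apply: eq_bigr => r _.
    by rewrite mxE ReM Re_intr Im_intr mul0r subr0.
  rewrite Im_sum; apply: eq_bigr => r _.
  by rewrite mxE ImM Re_intr Im_intr mul0r addr0.
pose u := S / znorm k ^+ 2; pose w := T / znorm k ^+ 2.
have cE : c = u +i* w.
  rewrite /c cd -fmorphV; set y := _^-1; apply/eqP; rewrite eq_complex /=.
  by rewrite !mulr0 subr0 add0r !eqxx.
have -> : \sum_(r < d) normc ((v k - c *: zvec k) ord0 r) ^+ 2 =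
  \sum_(r < d) normc (v k ord0 r) ^+ 2 - (S ^+ 2 + T ^+ 2) / znorm k ^+ 2.
  have -> : (S ^+ 2 + T ^+ 2) / znorm k ^+ 2 =
    2 * (u * S + w * T) - (u ^+ 2 + w ^+ 2) * znorm k ^+ 2.
    by rewrite /u /w; field; rewrite gt_eqF.
  rewrite /S /T znorm_sqr !mulr_sumr -big_split /= mulr_sumr -sumrB -sumrB.
  apply: eq_bigr => r _; rewrite !normc_sqr !mxE cE.
  case: (v k ord0 r) => x y /=.
  have -> : (k ord0 r)%:~R = ((k ord0 r)%:~R : R)%:C by rewrite rmorph_int.
  by rewrite /=; ring.
by rewrite gerBl divr_ge0 ?addr_ge0 ?sqr_ge0.
Qed.

End Lattice.

(** * Iterated integrals over the torus *)

Section TorusIntegral.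
Context {R : realType}.
Local Notation mu := (@lebesgue_measure R).
Local Notation L := (2 * pi : R).

(** The function of the remaining variables obtained by freezing the first one;
    [torus_rint] integrates it out last. *)
Definition slice d (f : 'rV[R]_d.+1 -> R) (t : R) : 'rV[R]_d -> R :=
  fun y => f (row_mx (t%:M : 'rV[R]_1) y).

(** The measurability needed for an iterated integral to be meaningful, asked
    of one variable at a time. *)
Fixpoint iter_measurable d : ('rV[R]_d -> R) -> Prop :=
  match d with
  | 0 => fun=> True
  | d'.+1 => fun f => (forall t, iter_measurable (slice f t)) /\
      measurable_fun [set: R] (fun t => torus_rint (slice f t))
  end.

Lemma period_gt0 : 0 < L.
Proof. by rewrite mulr_gt0 ?pi_gt0. Qed.

Lemma mu_period : mu `[0, L] = L%:E.
Proof. by rewrite lebesgue_measure_itv /= lte_fin period_gt0 sube0. Qed.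

Lemma integrable_period (g : R -> R) (M : R) :
  measurable_fun [set: R] g -> (forall t, `|g t| <= M) ->
  mu.-integrable `[0, L] (EFin \o g).
Proof.
move=> mg gM; apply: measurable_bounded_integrable => //.
- by rewrite [X in (X < _)%E]mu_period ltry.
- exact: measurable_funS mg.
- exists M; split; first exact: num_real.
  by move=> y My x _ /=; apply: le_trans (gM x) (ltW My).
Qed.

Lemma normr_torus_rint d (f : 'rV[R]_d -> R) (M : R) :
  iter_measurable f -> (forall x, `|f x| <= M) -> `|torus_rint f| <= M * L ^+ d.
Proof.
elim: d f => [|d IH] f /=; first by rewrite expr0 mulr1 => _ ->.
move=> [mf1 mf2] fM.
have bd t : `|torus_rint (slice f t)| <= M * L ^+ d.
  by apply: IH => // y; exact: fM.
have i1 := integrable_period mf2 bd.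
apply: le_trans (le_normr_Rintegral _ i1) _ => //.
apply: (@le_trans _ _ (\int[mu]_(t in `[0, L]) (M * L ^+ d))).
  apply: le_Rintegral => //.
    exact: integrable_norm i1.
  apply: (@integrable_period _ `|M * L ^+ d|) => //.
by rewrite Rintegral_cst //= mu_period /= -mulrA -exprSr.
Qed.

Lemma torus_rintD d (f g : 'rV[R]_d -> R) (M N : R) :
  iter_measurable f -> iter_measurable g ->
  (forall x, `|f x| <= M) -> (forall x, `|g x| <= N) ->
  iter_measurable (fun x => f x + g x) /\
  torus_rint (fun x => f x + g x) = torus_rint f + torus_rint g.
Proof.
elim: d f g => [|d IH] f g //= [mf1 mf2] [mg1 mg2] fM gN.
have sD t := IH (slice f t) (slice g t) (mf1 t) (mg1 t) (fun y => fM _) (fun y => gN _).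
have e : (fun t => torus_rint (slice (fun x => f x + g x) t)) =
    (fun t => torus_rint (slice f t) + torus_rint (slice g t)).
  by apply/funext => t; exact: (sD t).2.
split; first by split=> [t|]; [exact: (sD t).1 | rewrite e; exact: measurable_funD].
transitivity (\int[mu]_(t in `[0, L]) (torus_rint (slice f t) + torus_rint (slice g t))).
  by apply: eq_Rintegral => t _; exact: (sD t).2.
rewrite RintegralD //.
  by apply: (@integrable_period _ (M * L ^+ d) mf2) => t; apply: normr_torus_rint => // y; exact: fM.
by apply: (@integrable_period _ (N * L ^+ d) mg2) => t; apply: normr_torus_rint => // y; exact: gN.
Qed.

Lemma torus_rintZ d (f : 'rV[R]_d -> R) (M c : R) :
  iter_measurable f -> (forall x, `|f x| <= M) ->
  iter_measurable (fun x => c * f x) /\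
  torus_rint (fun x => c * f x) = c * torus_rint f.
Proof.
elim: d f => [|d IH] f //= [mf1 mf2] fM.
have sD t := IH (slice f t) (mf1 t) (fun y => fM _).
have e : (fun t => torus_rint (slice (fun x => c * f x) t)) =
    (fun t => c * torus_rint (slice f t)).
  by apply/funext => t; exact: (sD t).2.
split; first by split=> [t|]; [exact: (sD t).1 | rewrite e; exact: measurable_funM].
transitivity (\int[mu]_(t in `[0, L]) (c * torus_rint (slice f t))).
  by apply: eq_Rintegral => t _; exact: (sD t).2.
rewrite RintegralZl //.
by apply: (@integrable_period _ (M * L ^+ d) mf2) => t; apply: normr_torus_rint => // y; exact: fM.
Qed.

(** Dominated convergence, one variable at a time: by induction the inner
    integrals converge for each t, and they are bounded by M (2 pi)^d. *)
Lemma torus_rint_dominated d (f_ : nat -> 'rV[R]_d -> R) (f : 'rV[R]_d -> R) (M : R) :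
  (forall N, iter_measurable (f_ N)) -> (forall N x, `|f_ N x| <= M) ->
  (forall x, f_ N x @[N --> \oo] --> f x) ->
  iter_measurable f /\ torus_rint (f_ N) @[N --> \oo] --> torus_rint f.
Proof.
elim: d f_ f => [|d IH] f_ f /= mf fM ff; first by split=> //; exact: ff.
have sD t := IH (fun N => slice (f_ N) t) (slice f t) (fun N => (mf N).1 t)
  (fun N y => fM N _) (fun y => ff _).
have mg : measurable_fun [set: R] (fun t => torus_rint (slice f t)).
  apply: (@measurable_fun_cvg _ _ _ _ (fun N t => torus_rint (slice (f_ N) t))).
    by move=> N; exact: (mf N).2.
  by move=> t _; exact: (sD t).2.
split; first by split=> [t|//]; exact: (sD t).1.
have bd N t : `|torus_rint (slice (f_ N) t)| <= M * L ^+ d.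
  by apply: normr_torus_rint; [exact: (mf N).1 | move=> y; exact: fM].
have := @dominated_convergence _ _ R mu `[0, L] _
  (fun N t => (torus_rint (slice (f_ N) t))%:E) (fun t => (torus_rint (slice f t))%:E)
  (cst (M * L ^+ d)%:E).
case=> //.
- by move=> N; apply/measurable_EFinP; apply: measurable_funS (mf N).2.
- by apply/measurable_EFinP; apply: measurable_funS mg.
- by apply: aeW => t _; apply/cvg_EFin; [near=> N | exact: (sD t).2].
- by apply: (@integrable_period _ `|M * L ^+ d|).
- by apply: aeW => t N _; rewrite lee_fin bd.
move=> ig _ cv; apply: fine_cvg.
by rewrite fineK //; exact: integrable_fin_num.
Unshelve. all: by end_near. Qed.

(** For m nonzero, sin (th + m t) / m is an antiderivative of period 2 pi. *)
Lemma Rintegral_cos_period (m : int) (th : R) :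
  \int[mu]_(t in `[0, L]) cos (th + m%:~R * t) = (m == 0)%:R * L * cos th.
Proof.
have [->|m0] := eqVneq m 0.
  transitivity (\int[mu]_(t in `[0, L]) (cos th)).
    by apply: eq_Rintegral => t _; rewrite mul0r addr0.
  by rewrite Rintegral_cst //= mu_period /= mul1r mulrC.
rewrite !mul0r.
have mR : m%:~R != 0 :> R by rewrite intr_eq0.
pose F (t : R) : R := sin (th + m%:~R * t) / m%:~R.
have dF (t : R) : is_derive t 1 F (cos (th + m%:~R * t)).
  rewrite /F; apply: is_derive_eq.
  by rewrite /GRing.scale /= !mulr0 !add0r mul1r mulr1 mulrCA mulVf // mulr1.
have cF : continuous F.
  move=> t; apply: differentiable_continuous; apply/derivable1_diffP.
  by have [] := dF t.
have cc : continuous (fun t : R => cos (th + m%:~R * t)).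
  move=> t; apply: continuous_comp; last exact: continuous_cos.
  by apply: cvgD; [exact: cvg_cst | apply: cvgM; [exact: cvg_cst | exact: cvg_id]].
have pern (x : R) n : sin (x + n%:R * L) = sin x.
  have -> : n%:R * L = pi *+ 2 *+ n by rewrite -[pi *+ 2]mulr_natl -[RHS]mulr_natl.
  exact: periodicn (@sinD2pi R) n x.
have per : sin (th + m%:~R * L) = sin th.
  case: (intP m) => [|n|n]; first by rewrite mul0r addr0.
    by rewrite -pmulrn pern.
  by rewrite -(pern _ n.+1) -addrA mulrNz mulNr -pmulrn addNr addr0.
have := continuous_FTC2 period_gt0 (continuous_subspaceT cc) _ _ .
move=> /(_ F) h; rewrite /Rintegral h /=.
- by rewrite /F per mulr0 addr0 subrr.
- split=> [t _||]; first by have [] := dF t.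
    by apply: cvg_at_right_filter; exact: cF.
  by apply: cvg_at_left_filter; exact: cF.
- by move=> t _; rewrite derive1E; have [] := dF t.
Qed.

Definition dotx d (k : 'rV[int]_d) (x : 'rV[R]_d) : R :=
  \sum_(r < d) (k ord0 r)%:~R * x ord0 r.

(** The free phase th makes the induction on d work: after freezing the first
    variable at t the phase becomes th + k_0 t.  With th = 0 and th = -pi/2
    this gives the real and the imaginary part of the integral of a mode. *)
Lemma torus_rint_cos d (k : 'rV[int]_d) (th : R) :
  iter_measurable (fun x => cos (th + dotx k x)) /\
  torus_rint (fun x => cos (th + dotx k x)) = (k == 0)%:R * L ^+ d * cos th.
Proof.
elim: d k th => [|d IH] k th.
  by split=> //=; rewrite /dotx big_ord0 addr0 thinmx0 eqxx expr0 !mul1r.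
pose k' : 'rV[int]_d := \row_r k ord0 (lift ord0 r).
have kE : (k == 0) = (k ord0 ord0 == 0) && (k' == 0).
  apply/eqP/andP => [e|[/eqP e0 /eqP e']].
    by rewrite /k' e mxE; split=> //; apply/eqP/rowP => r; rewrite !mxE.
  apply/rowP => r; rewrite [RHS]mxE; case: (unliftP ord0 r) => [j|] -> //.
  by have /rowP/(_ j) := e'; rewrite !mxE.
have dE t y : dotx k (row_mx (t%:M : 'rV[R]_1) y) = (k ord0 ord0)%:~R * t + dotx k' y.
  rewrite /dotx big_ord_recl; congr (_ * _ + _).
    transitivity (row_mx (t%:M : 'rV[R]_1) y ord0 (lshift d ord0)).
      by congr (fun_of_matrix _ _ _); exact: val_inj.
    by rewrite row_mxEl mxE eqxx mulr1n.
  apply: eq_bigr => r _; rewrite [k' _ _]mxE; congr (_ * _).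
  transitivity (row_mx (t%:M : 'rV[R]_1) y ord0 (rshift 1 r)).
    by congr (fun_of_matrix _ _ _); exact: val_inj.
  by rewrite row_mxEr.
have sE t : slice (fun x => cos (th + dotx k x)) t =
    (fun y => cos ((th + (k ord0 ord0)%:~R * t) + dotx k' y)).
  by apply/funext => y; rewrite /slice dE addrA.
have iE : (fun t => torus_rint (slice (fun x => cos (th + dotx k x)) t)) =
    (fun t => (k' == 0)%:R * L ^+ d * cos (th + (k ord0 ord0)%:~R * t)).
  by apply/funext => t; rewrite sE (IH _ _).2.
have mc : measurable_fun [set: R] (fun t => cos (th + (k ord0 ord0)%:~R * t)).
  apply: continuous_measurable_fun => t.
  apply: continuous_comp; last exact: continuous_cos.
  by apply: cvgD; [exact: cvg_cst | apply: cvgM; [exact: cvg_cst | exact: cvg_id]].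
split.
  split=> [t|]; first by rewrite sE; exact: (IH _ _).1.
  by rewrite iE; apply: measurable_funM.
transitivity (\int[mu]_(t in `[0, L]) ((k' == 0)%:R * L ^+ d * cos (th + (k ord0 ord0)%:~R * t))).
  by apply: eq_Rintegral => t _; have := congr1 (@^~ t) iE.
rewrite RintegralZl //; last first.
  by apply: (@integrable_period _ 1 mc) => t; exact: cos_max.
rewrite Rintegral_cos_period kE exprS.
case: (_ == 0); case: (_ == 0); rewrite /= ?(mul0r, mulr0) //.
by rewrite !mul1r mulrA [_ * L]mulrC.
Qed.

End TorusIntegral.

(** * Complex-valued integrals and Fourier modes *)

Lemma cvg_sum_seq (R : realType) (I : Type) (s : seq I) (u : I -> nat -> R) (l : I -> R) :
  (forall i, u i N @[N --> \oo] --> l i) ->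
  \sum_(i <- s) u i N @[N --> \oo] --> \sum_(i <- s) l i.
Proof.
move=> h; elim: s => [|i s IH].
  by rewrite big_nil; under eq_fun do rewrite big_nil; exact: cvg_cst.
by rewrite big_cons; under eq_fun do rewrite big_cons; exact: cvgD.
Qed.

Section ComplexLimits.
Context {R : realType}.
Implicit Types u w : nat -> R[i].

(** Convergence in C, componentwise, since [torus_int] and [csum] are defined
    by their real and imaginary parts. *)
Definition ccvg u (l : R[i]) :=
  complex.Re (u N) @[N --> \oo] --> complex.Re l /\
  complex.Im (u N) @[N --> \oo] --> complex.Im l.

Lemma ccvg_cst (l : R[i]) : ccvg (fun=> l) l.
Proof. by split; exact: cvg_cst. Qed.

Lemma ccvgM u w l m : ccvg u l -> ccvg w m -> ccvg (fun N => u N * w N) (l * m).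
Proof.
move=> [u1 u2] [w1 w2]; split.
  under eq_fun do rewrite ReM; rewrite ReM.
  by apply: cvgB; exact: cvgM.
under eq_fun do rewrite ImM; rewrite ImM.
by apply: cvgD; exact: cvgM.
Qed.

Lemma ccvg_sum (I : Type) (s : seq I) (u : I -> nat -> R[i]) (l : I -> R[i]) :
  (forall i, ccvg (u i) (l i)) ->
  ccvg (fun N => \sum_(i <- s) u i N) (\sum_(i <- s) l i).
Proof.
move=> h; split.
  under eq_fun do rewrite Re_sum; rewrite Re_sum.
  by apply: cvg_sum_seq => i; exact: (h i).1.
under eq_fun do rewrite Im_sum; rewrite Im_sum.
by apply: cvg_sum_seq => i; exact: (h i).2.
Qed.

End ComplexLimits.

Section ComplexTorusIntegral.
Local Open Scope complex_scope.
Context {R : realType} {d : nat}.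
Implicit Types f g : 'rV[R]_d -> R[i].

(** A class of bounded functions on which the complex iterated integral is
    linear, and which contains the trigonometric polynomials. *)
Definition tame f :=
  [/\ iter_measurable (fun x => complex.Re (f x)),
      iter_measurable (fun x => complex.Im (f x)) &
      exists M : R, forall x, normc (f x) <= M].

Lemma torus_intD f g : tame f -> tame g ->
  tame (fun x => f x + g x) /\
  torus_int (fun x => f x + g x) = torus_int f + torus_int g.
Proof.
move=> [rf jf [M fM]] [rg jg [N gN]].
have bR (h : _ -> R[i]) (K : R) : (forall x, normc (h x) <= K) ->
    forall x : 'rV[R]_d, `|complex.Re (h x)| <= K.
  by move=> hK x; apply: le_trans (normr_Re_le _) (hK x).
have bI (h : _ -> R[i]) (K : R) : (forall x, normc (h x) <= K) ->
    forall x : 'rV[R]_d, `|complex.Im (h x)| <= K.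
  by move=> hK x; apply: le_trans (normr_Im_le _) (hK x).
have [mr er] := torus_rintD rf rg (bR _ _ fM) (bR _ _ gN).
have [mi ei] := torus_rintD jf jg (bI _ _ fM) (bI _ _ gN).
have eR : (fun x => complex.Re (f x + g x)) = (fun x => complex.Re (f x) + complex.Re (g x)).
  by apply/funext => x; exact: ReD.
have eI : (fun x => complex.Im (f x + g x)) = (fun x => complex.Im (f x) + complex.Im (g x)).
  by apply/funext => x; exact: ImD.
split; last by rewrite /torus_int eR eI er ei.
split; rewrite ?eR ?eI //; exists (M + N) => x.
by apply: le_trans (le_normcD _ _) _; exact: lerD.
Qed.

Lemma torus_intZ c f : tame f ->
  tame (fun x => c * f x) /\ torus_int (fun x => c * f x) = c * torus_int f.
Proof.
move=> [rf jf [M fM]].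
have bR x : `|complex.Re (f x)| <= M by apply: le_trans (normr_Re_le _) (fM x).
have bI x : `|complex.Im (f x)| <= M by apply: le_trans (normr_Im_le _) (fM x).
case: c => a b.
have [rr1 rr2] := torus_rintZ a rf bR.
have [ir1 ir2] := torus_rintZ b rf bR.
have [ri1 ri2] := torus_rintZ a jf bI.
have [nii1 nii2] := torus_rintZ (- b) jf bI.
have bZ (k : R) (h : 'rV[R]_d -> R) : (forall x, `|h x| <= M) -> forall x, `|k * h x| <= `|k| * M.
  by move=> hM x; rewrite normrM ler_wpM2l.
have [s1 s2] := torus_rintD rr1 nii1 (bZ _ _ bR) (bZ _ _ bI).
have [t1 t2] := torus_rintD ri1 ir1 (bZ _ _ bI) (bZ _ _ bR).
have eR : (fun x => complex.Re ((a +i* b) * f x)) =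
    (fun x => a * complex.Re (f x) + - b * complex.Im (f x)).
  by apply/funext => x; rewrite ReM /= mulNr.
have eI : (fun x => complex.Im ((a +i* b) * f x)) =
    (fun x => a * complex.Im (f x) + b * complex.Re (f x)).
  by apply/funext => x; rewrite ImM.
split.
  split; rewrite ?eR ?eI //; exists (normc (a +i* b) * M) => x.
  by rewrite Normc.normcM ler_wpM2l ?normc_ge0.
rewrite /torus_int eR eI s2 t2 rr2 ir2 ri2 nii2 mulNr.
by apply/eqP; rewrite eq_complex /= !eqxx.
Qed.

Lemma torus_int_sum (I : Type) (s : seq I) (f : I -> 'rV[R]_d -> R[i]) :
  (forall i, tame (f i)) ->
  tame (fun x => \sum_(i <- s) f i x) /\
  torus_int (fun x => \sum_(i <- s) f i x) = \sum_(i <- s) torus_int (f i).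
Proof.
move=> tf; elim: s => [|i s [IH1 IH2]].
  have t0 : tame (fun=> 0).
    have z : iter_measurable (fun=> 0 : R) (d := d).
      elim: (d) => //= n IH; split; first by move=> t; exact: IH.
      pose c : R := torus_rint (fun _ : 'rV[R]_n => 0).
      by rewrite (_ : (fun t => _) = cst c).
    by split=> //; exists 0 => x; rewrite Normc.normc0.
  have e0 : (fun x : 'rV[R]_d => \sum_(i <- [::]) f i x) = (fun=> 0).
    by apply/funext => x; rewrite big_nil.
  rewrite e0 big_nil; split=> //.
  have [_ e] := torus_intZ 0 t0; rewrite -[RHS](mul0r (torus_int (fun _ : 'rV[R]_d => 0))) -e.
  by congr torus_int; apply/funext => x; rewrite mul0r.
have e0 : (fun x : 'rV[R]_d => \sum_(j <- i :: s) f j x) =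
    (fun x => f i x + \sum_(j <- s) f j x).
  by apply/funext => x; rewrite big_cons.
by rewrite e0 big_cons -IH2; exact: torus_intD.
Qed.

Lemma torus_int_dominated (f_ : nat -> 'rV[R]_d -> R[i]) f (M : R) :
  (forall N, tame (f_ N)) -> (forall N x, normc (f_ N x) <= M) ->
  (forall x, ccvg (fun N => f_ N x) (f x)) ->
  ccvg (fun N => torus_int (f_ N)) (torus_int f).
Proof.
move=> tf fM ff; split => /=.
  have [||//] := @torus_rint_dominated R d (fun N x => complex.Re (f_ N x)) _ M _ _ (fun x => (ff x).1).
    by move=> N; have [] := tf N.
  by move=> N x; exact: le_trans (normr_Re_le _) (fM N x).
have [||//] := @torus_rint_dominated R d (fun N x => complex.Im (f_ N x)) _ M _ _ (fun x => (ff x).2).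
  by move=> N; have [] := tf N.
by move=> N x; exact: le_trans (normr_Im_le _) (fM N x).
Qed.

End ComplexTorusIntegral.

Section FourierModes.
Local Open Scope complex_scope.
Context {R : realType} {d : nat}.
Implicit Types (k l : 'rV[int]_d) (x : 'rV[R]_d).

(** The modulus of a normalized Fourier mode, which does not depend on k. *)
Definition mode_amp : R := ((2 * pi) `^ (d%:R / 2))^-1.

Lemma mode_amp_gt0 : 0 < mode_amp.
Proof. by rewrite invr_gt0 powR_gt0 // mulr_gt0 ?pi_gt0. Qed.

Lemma mode_amp_ge0 : 0 <= mode_amp.
Proof. exact: ltW mode_amp_gt0. Qed.

(** The normalization is orthonormal: (2 pi)^d is the square of the inverse of
    the amplitude. *)
Lemma mode_amp_period : mode_amp * (2 * pi) ^+ d = mode_amp^-1.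
Proof.
have p0 : 0 < 2 * pi :> R by rewrite mulr_gt0 ?pi_gt0.
rewrite /mode_amp invrK; set y := _ `^ _.
have -> : (2 * pi) ^+ d = y * y :> R.
  rewrite -powRD; last by apply/implyP => _; rewrite gt_eqF.
  by rewrite -splitr powR_mulrn // ltW.
by rewrite mulKf // gt_eqF // /y powR_gt0.
Qed.

Lemma fourier_modeE k x : fourier_mode k x =
  mode_amp%:C * (cos (dotx k x) +i* sin (dotx k x)).
Proof. by []. Qed.

Lemma normc_fourier_mode k x : normc (fourier_mode k x) = mode_amp.
Proof.
rewrite fourier_modeE Normc.normcM /= expr0n /= addr0 sqrtr_sqr.
by rewrite cos2Dsin2 sqrtr1 mulr1 gtr0_norm // mode_amp_gt0.
Qed.

Lemma dotxD k l x : dotx (k + l) x = dotx k x + dotx l x.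
Proof.
by rewrite /dotx -big_split /=; apply: eq_bigr => r _; rewrite mxE intrD mulrDl.
Qed.

Lemma fourier_modeM k l x :
  fourier_mode k x * fourier_mode l x = mode_amp%:C * fourier_mode (k + l) x.
Proof.
rewrite !fourier_modeE dotxD cosD sinD mulrACA -mulrA; congr (_ * (_ * _)).
by apply/eqP; rewrite eq_complex /= eqxx /= addrC mulrC [X in _ + X]mulrC [sin _ * _]mulrC.
Qed.

Lemma torus_int_fourier_mode k :
  tame (fourier_mode (R := R) k) /\
  torus_int (fourier_mode (R := R) k) = (mode_amp^-1)%:C * (k == 0)%:R.
Proof.
have [mc ec] := torus_rint_cos k (0 : R).
have [ms es] := torus_rint_cos k (- (pi / 2) : R).
have {}mc : iter_measurable (fun x : 'rV[R]_d => cos (dotx k x)).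
  by under eq_fun do rewrite -[dotx k _]add0r.
have {}ms : iter_measurable (fun x : 'rV[R]_d => sin (dotx k x)).
  by under eq_fun do rewrite -cosBpihalf addrC.
have {}ec : torus_rint (fun x : 'rV[R]_d => cos (dotx k x)) = (k == 0)%:R * (2 * pi) ^+ d.
  by under eq_fun do rewrite -[dotx k _]add0r; rewrite ec cos0 mulr1.
have {}es : torus_rint (fun x : 'rV[R]_d => sin (dotx k x)) = 0.
  by under eq_fun do rewrite -cosBpihalf addrC; rewrite es cosN cos_pihalf mulr0.
have bc x : `|cos (dotx k x) : R| <= 1 by exact: cos_max.
have bs x : `|sin (dotx k x) : R| <= 1 by exact: sin_max.
have t : tame (fun x : 'rV[R]_d => cos (dotx k x) +i* sin (dotx k x)).
  by split=> //; exists 1 => x; rewrite /= cos2Dsin2 sqrtr1.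
have [t1 t2] := torus_intZ (mode_amp%:C) t.
split; first exact: t1.
rewrite (_ : fourier_mode k = (fun x => mode_amp%:C * (cos (dotx k x) +i* sin (dotx k x)))) //.
rewrite t2 /torus_int /= ec es -mode_amp_period.
by case: (k == 0); apply/eqP; rewrite eq_complex /= ?(mul1r, mulr1, mul0r, mulr0, subr0, addr0) !eqxx.
Qed.

End FourierModes.

(** * Fourier coefficients of products *)

Section FourierProduct.
Local Open Scope complex_scope.
Context {R : realType} {d : nat}.
Local Notation index := 'rV[int]_d.
Local Notation amp := (@mode_amp R d).
Implicit Types (c : index -> R[i]) (x : 'rV[R]_d).

Definition fourier_partial N c x : R[i] :=
  \sum_(k <- exhaust N) c k * fourier_mode k x.

Lemma normc_fourier_term c g k x : normc (c k) <= g k ->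
  normc (c k * fourier_mode k x) <= amp * g k.
Proof.
by move=> h; rewrite Normc.normcM normc_fourier_mode mulrC ler_wpM2l // mode_amp_ge0.
Qed.

Lemma sums_leZ (T : eqType) (g : T -> R) (a B : R) :
  0 <= a -> sums_le g B -> sums_le (fun k => a * g k) (a * B).
Proof. by move=> a0 gB s us; rewrite -mulr_sumr ler_wpM2l // gB. Qed.

Lemma normc_fourier_partial N c g B x :
  (forall k, normc (c k) <= g k) -> sums_le g B ->
  normc (fourier_partial N c x) <= amp * B.
Proof.
move=> cg gB; apply: le_trans (normc_sum _ _ _) _.
apply: le_trans (sums_leZ (mode_amp_ge0 (d := d)) gB (exhaust_uniq N)).
by apply: ler_sum => k _; exact: normc_fourier_term.
Qed.

Lemma ccvg_fourier_partial c g B x :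
  (forall k, normc (c k) <= g k) -> sums_le g B ->
  ccvg (fun N => fourier_partial N c x) (fourier_sum c x).
Proof.
move=> cg gB; have gB' := sums_leZ (mode_amp_ge0 (d := d)) gB; split.
  under eq_fun do rewrite Re_sum; apply: (rsum_exhaust (g := fun k => amp * g k) _ gB') => k.
  exact: le_trans (normr_Re_le _) (normc_fourier_term _ (cg k)).
under eq_fun do rewrite Im_sum; apply: (rsum_exhaust (g := fun k => amp * g k) _ gB') => k.
exact: le_trans (normr_Im_le _) (normc_fourier_term _ (cg k)).
Qed.

(** Expanding the triple product gives modes of frequency h + l - k, whose
    integrals vanish unless h + l = k; the three amplitudes and the integral of
    the constant mode combine into a single amplitude. *)
Lemma fourier_coef_trig_product (I : Type) (J : seq I) (a b : I -> index -> R[i]) N k :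
  let f x := fourier_mode (- k) x *
    \sum_(r <- J) fourier_partial N (a r) x * fourier_partial N (b r) x in
  tame f /\ torus_int f = amp%:C *
    \sum_(r <- J) \sum_(h <- exhaust N) \sum_(l <- exhaust N)
      a r h * b r l * (h + l == k)%:R.
Proof.
move=> f; pose t (q : I) h l x : R[i] := amp%:C ^+ 2 * (a q h * b q l) * fourier_mode (h + l - k) x.
have tt q h l : tame (t q h l) /\
    torus_int (t q h l) = amp%:C * (a q h * b q l * (h + l == k)%:R).
  have [m1 m2] := torus_int_fourier_mode (R := R) (h + l - k).
  have [n1 n2] := torus_intZ (amp%:C ^+ 2 * (a q h * b q l)) m1.
  split; first exact: n1.
  have e1 : amp%:C * (amp^-1)%:C = 1 :> R[i].
    by rewrite -rmorphM divff ?rmorph1 // gt_eqF // mode_amp_gt0.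
  rewrite /t n2 m2 subr_eq0.
  transitivity (amp%:C * (a q h * b q l * (h + l == k)%:R) * (amp%:C * (amp^-1)%:C)).
    by ring.
  by rewrite e1 mulr1.
have -> : f = fun x => \sum_(q <- J) \sum_(h <- exhaust N) \sum_(l <- exhaust N) t q h l x.
  apply/funext => x; rewrite /f mulr_sumr; apply: eq_bigr => q _.
  rewrite /fourier_partial mulr_suml mulr_sumr; apply: eq_bigr => h _.
  rewrite !mulr_sumr; apply: eq_bigr => l _.
  transitivity (a q h * b q l * (fourier_mode (- k) x * (fourier_mode h x * fourier_mode l x))).
    by ring.
  rewrite fourier_modeM.
  transitivity (a q h * b q l * amp%:C * (fourier_mode (h + l) x * fourier_mode (- k) x)).
    by ring.
  by rewrite fourier_modeM /t; ring.
have t2 q h := torus_int_sum (exhaust N) (fun l => (tt q h l).1).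
have t3 q := torus_int_sum (exhaust N) (fun h => (t2 q h).1).
have [t4 ->] := torus_int_sum J (fun q => (t3 q).1).
split; first exact: t4.
rewrite mulr_sumr; apply: eq_bigr => q _; rewrite (t3 q).2.
rewrite mulr_sumr; apply: eq_bigr => h _; rewrite (t2 q h).2.
by rewrite mulr_sumr; apply: eq_bigr => l _; rewrite (tt q h l).2.
Qed.

(** Partial sums of absolutely convergent Fourier series converge pointwise and
    are uniformly bounded, so dominated convergence applies to the product. *)
Lemma fourier_coef_product_cvg (I : Type) (J : seq I) (a b : I -> index -> R[i])
    (g1 g2 : index -> R) (B1 B2 : R) k :
  (forall r h, normc (a r h) <= g1 h) -> (forall r h, normc (b r h) <= g2 h) ->
  sums_le g1 B1 -> sums_le g2 B2 ->
  ccvg (fun N => amp%:C * \sum_(r <- J) \sum_(h <- exhaust N) \sum_(l <- exhaust N)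
          a r h * b r l * (h + l == k)%:R)
    (fourier_coef (fun x => \sum_(r <- J) fourier_sum (a r) x * fourier_sum (b r) x) k).
Proof.
move=> ag bg gB1 gB2.
have tN N := fourier_coef_trig_product J a b N k.
under eq_fun do rewrite -(tN _).2.
apply: (torus_int_dominated (M := amp * \sum_(r <- J) (amp * B1) * (amp * B2))).
- by move=> N; exact: (tN N).1.
- move=> N x; rewrite Normc.normcM normc_fourier_mode ler_wpM2l ?mode_amp_ge0 //.
  apply: le_trans (normc_sum _ _ _) _; apply: ler_sum => r _.
  rewrite Normc.normcM ler_pM ?normc_ge0 //.
    exact: normc_fourier_partial gB1.
  exact: normc_fourier_partial gB2.
move=> x; apply: ccvgM; first exact: ccvg_cst.
apply: ccvg_sum => r; apply: ccvgM.
  exact: ccvg_fourier_partial gB1.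
exact: ccvg_fourier_partial gB2.
Qed.

End FourierProduct.

Section Advection.
Local Open Scope complex_scope.
Context {R : realType} {d : nat}.
Local Notation index := 'rV[int]_d.
Local Notation amp := (@mode_amp R d).
Implicit Types v w : coefs R d.

(** The k-th coefficient of V . grad W, for V and W the N-th partial sums of the
    Fourier series of v and w. *)
Definition advection_partial N v w (k : index) : 'rV[R[i]]_d :=
  \sum_(h <- exhaust N) \sum_(l <- exhaust N)
    (amp%:C * (h + l == k)%:R * (0 +i* 1) * cdot (v h) (zvec l)) *: w l.

(** Only l = k - h contributes, and |v_h . l| <= |v_h| |l|.  The bound drops the
    condition that l lies in the N-th finite set, which turns it into a
    convolution of fixed families. *)
Lemma enorm_advection_partial N v w k :
  enorm (advection_partial N v w k) <=
  amp * \sum_(h <- exhaust N) enorm (v h) * (znorm (k - h) * enorm (w (k - h))).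
Proof.
apply: le_trans (enorm_sum _ _) _; rewrite mulr_sumr; apply: ler_sum => h _.
apply: le_trans (enorm_sum _ _) _.
pose y := amp * (enorm (v h) * (znorm (k - h) * enorm (w (k - h)))).
have y0 : 0 <= y by rewrite /y !mulr_ge0 ?enorm_ge0 // mode_amp_ge0.
have le1 l : enorm ((amp%:C * (h + l == k)%:R * (0 +i* 1) * cdot (v h) (zvec l)) *: w l)
    <= (if l == k - h then y else 0).
  have -> : (h + l == k) = (l == k - h) by rewrite addrC eq_sym -subr_eq eq_sym.
  rewrite enormZ !Normc.normcM; case: eqP => [->|_]; last first.
    by rewrite [normc 0]Normc.normc0 mulr0 !mul0r.
  rewrite [normc 1]Normc.normc1 mulr1.
  have -> : normc (amp%:C : R[i]) = amp.
    by rewrite /= expr0n addr0 sqrtr_sqr gtr0_norm // mode_amp_gt0.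
  have -> : normc (0 +i* 1 : R[i]) = 1 by rewrite /= expr0n expr1n add0r sqrtr1.
  rewrite mulr1 /y -mulrA ler_wpM2l ?mode_amp_ge0 // mulrA.
  by rewrite ler_wpM2r ?enorm_ge0 // normc_cdot.
apply: (le_trans (ler_sum _ (fun l _ => le1 l))).
rewrite -big_mkcond /= big_const_seq iter_addr_0.
rewrite [count _ _](_ : _ = (k - h \in exhaust N) :> nat).
  by case: (_ \in _).
by apply: count_uniq_mem; exact: exhaust_uniq.
Qed.

Lemma advection_cvg v w B1 B2 k s :
  sums_le (fun h => enorm (v h)) B1 ->
  sums_le (fun l => znorm l * enorm (w l)) B2 ->
  ccvg (fun N => advection_partial N v w k ord0 s) (advection v w k ord0 s).
Proof.
move=> vB wB; rewrite /advection mxE.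
have ag (r : 'I_d) h : normc (vcomp v r h) <= enorm (v h) by exact: normc_le_enorm.
have bg (r : 'I_d) l : normc (partial r (vcomp w s) l) <= znorm l * enorm (w l).
  rewrite /partial Normc.normcM ler_pM ?normc_ge0 //; last exact: normc_le_enorm.
  rewrite /= expr0n add0r sqrtr_sqr; exact: normr_coord_le_znorm.
have := fourier_coef_product_cvg (index_enum 'I_d) k ag bg vB wB.
congr (ccvg _ _); apply/funext => N.
rewrite /advection_partial summxE exchange_big /= mulr_sumr; apply: eq_bigr => h _.
rewrite summxE exchange_big /= mulr_sumr; apply: eq_bigr => l _.
rewrite mxE /cdot !mulr_sumr mulr_suml; apply: eq_bigr => r _.
rewrite /vcomp /partial [zvec l _ _]mxE.
have -> : 0 +i* (l ord0 r)%:~R = (0 +i* 1) * (l ord0 r)%:~R :> R[i].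
  by apply/eqP; rewrite eq_complex ReM ImM Re_intr Im_intr /= !mul0r !mulr0 mul1r subr0 add0r !eqxx.
by ring.
Qed.

Lemma enorm_advection_cvg v w B1 B2 k :
  sums_le (fun h => enorm (v h)) B1 ->
  sums_le (fun l => znorm l * enorm (w l)) B2 ->
  enorm (advection_partial N v w k) ^+ 2 @[N --> \oo] --> enorm (advection v w k) ^+ 2.
Proof.
move=> vB wB; rewrite enorm_sqr; under eq_fun do rewrite enorm_sqr.
apply: cvg_sum_seq => s; have [c1 c2] := advection_cvg k s vB wB.
rewrite normc_sqr; under eq_fun do rewrite normc_sqr.
by rewrite !expr2; under eq_fun do rewrite !expr2; apply: cvgD; apply: cvgM.
Qed.

End Advection.

(** * Finiteness of the lattice zeta function *)

Section LatticeZeta.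
Context {R : realType}.

Lemma geometric_sum_le (rho : R) N : 0 <= rho -> rho < 1 ->
  \sum_(j < N) rho ^+ j <= (1 - rho)^-1.
Proof.
move=> r0 r1; have d0 : 0 < 1 - rho by rewrite subr_gt0.
rewrite -[leRHS]mul1r ler_pdivlMr // mulrC -[leLHS]opprK -mulNr opprB -subrX1 opprB.
by rewrite lerBlDr lerDl exprn_ge0.
Qed.

(** The block of indices from 2^j to 2^(j+1) - 1 has 2^j terms, each at most
    2^(-jq). *)
Lemma dyadic_sum_le (q : R) N : 0 < q ->
  \sum_(1 <= i < 2 ^ N) (i%:R `^ q)^-1 <= \sum_(j < N) (2 * (2 `^ q)^-1) ^+ j :> R.
Proof.
move=> q0; elim: N => [|N IH]; first by rewrite expn0 big_geq // big_ord0.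
rewrite (big_cat_nat (n := 2 ^ N)) ?expn_gt0 ?leq_pexp2l //= big_ord_recr /=.
apply: lerD => //.
apply: (@le_trans _ _ (\sum_(2 ^ N <= i < 2 ^ N.+1) ((2 ^ N)%:R `^ q)^-1)).
  rewrite big_nat [leRHS]big_nat; apply: ler_sum => i /andP[i1 _].
  have i0 : (0 < i)%N by apply: leq_trans i1; rewrite expn_gt0.
  rewrite lef_pV2 ?posrE ?powR_gt0 ?ltr0n ?expn_gt0 //.
  by rewrite ge0_ler_powR ?nnegrE ?ler0n ?ler_nat // ltW.
rewrite sumr_const_nat expnS mul2n -addnn addnK exprMn -[leLHS]mulr_natl natrX exprVn.
have -> : (2 ^+ N) `^ q = (2 `^ q) ^+ N :> R.
  by rewrite -powR_mulrn // powRAC powR_mulrn ?powR_ge0.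
by [].
Qed.

(** Shifting by 1 makes the weight 1 at 0, so that the product over the
    coordinates of a lattice point makes sense when some of them vanish. *)
Definition int_weight (q : R) (z : int) : R := ((1 + `|z|%:R) `^ q)^-1.

Lemma int_weight_ge0 q z : 0 <= int_weight q z.
Proof. by rewrite invr_ge0 powR_ge0. Qed.

Lemma sums_le_int_weight (q : R) : 1 < q -> exists B, sums_le (int_weight q) B.
Proof.
move=> q1; have q0 : 0 < q by apply: lt_trans q1.
pose rho : R := 2 * (2 `^ q)^-1.
have r0 : 0 <= rho by rewrite mulr_ge0 // invr_ge0 powR_ge0.
have r1 : rho < 1.
  rewrite /rho ltr_pdivrMr ?powR_gt0 // mul1r.
  rewrite /powR pnatr_eq0 /= -[ltLHS]lnK ?posrE // ltr_expR ltr_pMl //.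
  by rewrite ln_gt0 // ltr1n.
pose C := (1 - rho)^-1.
have natC M : \sum_(0 <= n < M) ((1 + n%:R) `^ q)^-1 <= C.
  apply: le_trans (geometric_sum_le M.+1 r0 r1).
  apply: le_trans (dyadic_sum_le M.+1 q0).
  rewrite [leRHS](big_cat_nat (n := M.+1)) //=; last exact/ltnW/ltn_expl.
  rewrite [X in _ <= X + _]big_add1 /= -[leLHS]addr0 lerD //.
    by rewrite le_eqVlt; apply/orP; left; apply/eqP; apply: eq_bigr => i _; rewrite -natr1 addrC.
  by apply: sumr_ge0 => i _; rewrite invr_ge0 powR_ge0.
exists (C + C) => s us.
pose M := (\sum_(z <- s) `|z|.+1)%N.
have sM z : z \in s -> (`|z| < M)%N.
  by move=> zs; rewrite /M (big_rem z zs) /= leq_addr.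
apply: (@le_trans _ _ (\sum_(z <- map Posz (iota 0 M) ++ map Negz (iota 0 M)) int_weight q z)).
  apply: ler_sum_subset => //; last exact: int_weight_ge0.
  move=> z zs; rewrite mem_cat; apply/orP; have := sM z zs; case: z {zs} => n nM.
    by left; apply: map_f; rewrite mem_iota.
  by right; apply: map_f; rewrite mem_iota; exact: ltnW.
rewrite big_cat !big_map; apply: lerD.
  by have := natC M; rewrite /index_iota subn0.
apply: le_trans (natC M); rewrite /index_iota subn0.
apply: ler_sum => n _; rewrite /int_weight /=.
rewrite lef_pV2 ?posrE ?powR_gt0 ?ltr_pwDl //.
by rewrite ge0_ler_powR ?nnegrE ?addr_ge0 ?lerD2l ?ler_nat // ltW.
Qed.

(** A finite set of lattice points lies in a box t^d, over which the sum of the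
    products factors. *)
Lemma sums_le_prod_coords (g : int -> R) (B : R) d :
  (forall z, 0 <= g z) -> sums_le g B ->
  sums_le (fun k : 'rV[int]_d => \prod_(r < d) g (k ord0 r)) (B ^+ d).
Proof.
move=> g0 gB s us.
pose t := undup [seq (p.1 : 'rV[int]_d) ord0 p.2 | p <- [seq (k, r) | k <- s, r <- enum 'I_d]].
have ut : uniq t by exact: undup_uniq.
pose row_of (f : {ffun 'I_d -> 'I_(size t)}) : 'rV[int]_d := \row_r nth 0 t (f r).
apply: (@le_trans _ _ (\sum_(k <- map row_of (enum {ffun 'I_d -> 'I_(size t)})) \prod_(r < d) g (k ord0 r))).
  apply: ler_sum_subset => //; last by move=> k; exact: prodr_ge0.
  move=> k ks.
  have kt r : k ord0 r \in t.
    rewrite mem_undup; apply/mapP; exists (k, r) => //.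
    by apply/allpairsP; exists (k, r); rewrite mem_enum.
  have ki r : (index (k ord0 r) t < size t)%N by rewrite index_mem.
  apply/mapP; exists [ffun r => Ordinal (ki r)]; first by rewrite mem_enum.
  by apply/rowP => r; rewrite mxE ffunE /= nth_index.
rewrite big_map big_enum /=.
have -> : \sum_(f : {ffun 'I_d -> 'I_(size t)}) \prod_(r < d) g (row_of f ord0 r) =
    \prod_(r < d) \sum_(j < size t) g (nth 0 t j).
  rewrite bigA_distr_bigA; apply: eq_bigr => f _; apply: eq_bigr => r _.
  by rewrite mxE.
have e : \sum_(j < size t) g (nth 0 t j) = \sum_(z <- t) g z.
  by rewrite (big_nth 0) big_mkord.
rewrite e prodr_const card_ord lerXn2r ?nnegrE ?sumr_ge0 ?gB //.
by have := gB [::] isT; rewrite big_nil.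
Qed.

Context {d : nat}.
Local Notation index := 'rV[int]_d.

(** For k nonzero, 1 + |k_r| <= 2 |k| for each of the d coordinates; raise this
    to the power s / d and multiply. *)
Lemma inv_znorm_powR_le (s : R) (k : index) : (0 < d)%N -> 0 < s -> k != 0 ->
  (znorm k `^ s)^-1 <= 2 `^ s * \prod_(r < d) int_weight (s / d%:R) (k ord0 r).
Proof.
move=> d0 s0 k0; have k1 := znorm_ge1 (R := R) k0.
have dR : 0 < d%:R :> R by rewrite ltr0n.
have kp : 0 < znorm k :> R by apply: lt_le_trans k1.
have kp0 := ltW kp.
have q0 : 0 <= s / d%:R by rewrite divr_ge0 // ltW.
have kq : (2 * znorm k) `^ s = \prod_(r < d) (2 * znorm k) `^ (s / d%:R) :> R.
  rewrite prodr_const card_ord -powR_mulrn ?powR_ge0 // -powRrM divfK // gt_eqF //.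
rewrite -[leLHS]mulr1 -[X in _ * X <= _](divff (x := 2 `^ s)); last by rewrite gt_eqF // powR_gt0.
rewrite mulrCA ler_wpM2l ?powR_ge0 // -invfM -powRM // mulrC kq -prodfV.
apply: ler_prod => r _; rewrite invr_ge0 powR_ge0 /= /int_weight.
have h1 : 0 < 1 + `|k ord0 r|%:R :> R by rewrite ltr_pwDl.
rewrite lef_pV2 ?posrE ?powR_gt0 ?mulr_gt0 //.
rewrite ge0_ler_powR ?nnegrE ?(ltW h1) //; first by rewrite mulr_ge0.
rewrite mulr_natl mulr2n lerD //.
by apply: le_trans (normr_coord_le_znorm k r); rewrite -intr_norm pmulrn.
Qed.

(** [zeta] is defined through [fine], which would turn an infinite sum into 0. *)
Lemma zeta_finite (s : R) : (0 < d)%N -> d%:R < s ->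
  (\esum_(h in [set h : index | h != 0%R]) ((znorm h `^ s)^-1)%:E)%E = (zeta d s)%:E.
Proof.
move=> d0 ds; have dR : 0 < d%:R :> R by rewrite ltr0n.
have s0 : 0 < s by apply: lt_trans ds.
have [B gB] : exists B, sums_le (int_weight (s / d%:R)) B.
  by apply: sums_le_int_weight; rewrite ltr_pdivlMr // mul1r.
have pB := @sums_le_prod_coords (int_weight (s / d%:R)) B d (int_weight_ge0 _) gB.
rewrite /zeta fineK // ge0_fin_numE.
  apply: (@le_lt_trans _ _ (2 `^ s * B ^+ d)%:E); last by rewrite ltry.
  apply: esum_le_sums => t ut t0; apply: le_trans (ler_wpM2l (powR_ge0 _ _) (pB t ut)).
  rewrite mulr_sumr big_seq [leRHS]big_seq; apply: ler_sum => k kt.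
  by apply: inv_znorm_powR_le => //; exact: t0.
by apply: esum_ge0 => k _; rewrite lee_fin invr_ge0 powR_ge0.
Qed.

(** The term k = 0 may be included: since n > 0, both 0^n and its formal
    inverse are 0. *)
Lemma sums_le_zeta (n : R) : (0 < d)%N -> d%:R / 2 < n ->
  sums_le (fun k : index => (znorm k `^ n)^-1 ^+ 2) (zeta d (2 * n)).
Proof.
move=> d0 dn t ut.
have n0 : 0 < n by apply: le_lt_trans dn; rewrite divr_ge0.
have sq (k : index) : ((znorm k : R) `^ n)^-1 ^+ 2 = (znorm k `^ (2 * n))^-1.
  by rewrite exprVn -powR_mulrn ?powR_ge0 // -powRrM mulrC.
rewrite (bigID (fun k => k == 0)) /= big1 ?add0r; last first.
  by move=> k /eqP ->; rewrite znorm0 powR0 ?gt_eqF // invr0 expr0n.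
under eq_bigr do rewrite sq.
rewrite -big_filter -lee_fin -zeta_finite //; last by rewrite -ltr_pdivrMl // mulrC.
apply: sums_le_esum; first exact: filter_uniq.
by move=> k; rewrite mem_filter => /andP[].
Qed.

Lemma zeta_gt0 (s : R) : (0 < d)%N -> d%:R < s -> 0 < zeta d s.
Proof.
move=> d0 ds; pose k : index := const_mx 1.
have k0 : k != 0.
  by apply/eqP => /rowP /(_ (Ordinal d0)); rewrite !mxE.
have kp : 0 < znorm k :> R by apply: lt_le_trans (znorm_ge1 k0).
rewrite -lte_fin -zeta_finite //.
apply: (@lt_le_trans _ _ (\sum_(h <- [:: k]) (znorm h `^ s)^-1)%:E).
  by rewrite big_seq1 lte_fin invr_gt0 powR_gt0.
by apply: sums_le_esum => // i; rewrite inE => /eqP ->.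
Qed.

End LatticeZeta.

(** * The convolution estimate for the projected advection term *)

Section WeightedNorms.
Context {R : realType} {d : nat}.
Local Notation index := 'rV[int]_d.
Local Notation amp := (@mode_amp R d).
Implicit Types (v w : coefs R d) (k h : index).

(** The family whose l2 norm over nonzero k is |v|_m. *)
Definition weighted (m : R) v k : R := znorm k `^ m * enorm (v k).

Lemma weighted_ge0 m v k : 0 <= weighted m v k.
Proof. by rewrite mulr_ge0 ?powR_ge0 ?enorm_ge0. Qed.

Lemma weighted_sqr m v k :
  weighted m v k ^+ 2 = znorm k `^ (2 * m) * enorm (v k) ^+ 2.
Proof.
rewrite /weighted exprMn; congr (_ * _).
by rewrite -powR_mulrn ?powR_ge0 // -powRrM mulrC.
Qed.

Lemma hnorm_le m v (X : R) : 0 <= X ->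
  (forall s, uniq s -> (forall k, k \in s -> k != 0) ->
     \sum_(k <- s) weighted m v k ^+ 2 <= X ^+ 2) ->
  (hnorm m v <= X%:E)%E.
Proof.
move=> X0 h; have -> : X%:E = sqrte (X ^+ 2)%:E by rewrite /= sqrtr_sqr ger0_norm.
rewrite /hnorm lee_sqrt ?lee_fin ?sqr_ge0 //; apply: esum_le_sums => s us s0.
by under eq_bigr do rewrite -weighted_sqr; exact: h.
Qed.

(** For m nonzero the weight vanishes at k = 0, so the sum may run over all of
    the lattice, as the convolution estimates require. *)
Lemma hnorm_real m v : m != 0 -> (hnorm m v < +oo)%E ->
  exists X : R, [/\ 0 <= X, hnorm m v = X%:E &
    sums_le (fun k => weighted m v k ^+ 2) (X ^+ 2)].
Proof.
move=> m0; rewrite /hnorm; set E := (\esum_(_ in _) _)%E => Efin.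
have E0 : (0 <= E)%E.
  by apply: esum_ge0 => k _; rewrite lee_fin mulr_ge0 ?powR_ge0 ?sqr_ge0.
have Ef : E \is a fin_num by rewrite -(sqrte_fin_num E0) ge0_fin_numE // sqrte_ge0.
have fE0 : 0 <= fine E by exact: fine_ge0.
exists (Num.sqrt (fine E)); split; first exact: sqrtr_ge0.
  by rewrite -[in LHS](fineK Ef).
move=> s us; rewrite sqr_sqrtr //.
rewrite (bigID (fun k => k == 0)) /= big1 ?add0r; last first.
  by move=> k /eqP ->; rewrite /weighted znorm0 powR0 // mul0r expr0n.
rewrite -big_filter -lee_fin fineK //.
under eq_bigr do rewrite weighted_sqr.
apply: sums_le_esum; first exact: filter_uniq.
by move=> k; rewrite mem_filter => /andP[].
Qed.

Lemma hnorm_mono m1 m2 v : m1 <= m2 -> (hnorm m1 v <= hnorm m2 v)%E.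
Proof.
move=> m12; rewrite /hnorm lee_sqrt; last first.
  by apply: esum_ge0 => k _; rewrite lee_fin mulr_ge0 ?powR_ge0 ?sqr_ge0.
apply: le_esum => k /= k0; rewrite lee_fin ler_wpM2r ?sqr_ge0 //.
by rewrite ler_powR ?znorm_ge1 // ler_wpM2l.
Qed.

Lemma weightedS m v k : m + 1 != 0 ->
  weighted (m + 1) v k = znorm k `^ m * (znorm k * enorm (v k)).
Proof.
move=> m1; rewrite /weighted powRD; last by rewrite (negbTE m1).
by rewrite powRr1 ?znorm_ge0 // mulrA.
Qed.

(** |k| is at most twice the larger of |h| and |k - h|; the statement is
    symmetric in these, so the larger one may be taken to be |k - h|. *)
Lemma znorm_powR_split p k h : 0 <= p ->
  znorm k `^ p <= 2 `^ p * (znorm h `^ p + znorm (k - h) `^ p) :> R.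
Proof.
move=> p0.
have tri : znorm k <= znorm h + znorm (k - h) :> R.
  by apply: le_trans (znormD _ _); rewrite addrC subrK.
have h0 := @znorm_ge0 R d h; have k0 := @znorm_ge0 R d (k - h).
wlog hk : h tri h0 k0 / znorm h <= znorm (k - h) :> R.
  move=> W; have [hk|/ltW hk] := leP (znorm h : R) (znorm (k - h)); first exact: W.
  by have := W (k - h); rewrite subKr addrC [X in _ -> _ <= _ * X]addrC; apply.
apply: (@le_trans _ _ ((2 * znorm (k - h)) `^ p)).
  rewrite ge0_ler_powR ?nnegrE ?znorm_ge0 //; first by rewrite mulr_ge0.
  by apply: le_trans tri _; rewrite mulr_natl mulr2n lerD2r.
by rewrite powRM // ler_wpM2l ?powR_ge0 // lerDr powR_ge0.
Qed.

(** The main estimate.  For each N the weighted coefficients of the product of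
    the N-th partial sums are dominated by x + y with x and y the two
    convolutions, and the bound does not depend on N; the limit is taken for
    each finite set of frequencies separately. *)
Lemma hnorm_calP_le (p : R) v w (A0 Ap B1 Bp : R) : 0 < p -> 0 <= Ap -> 0 <= Bp ->
  sums_le (fun h => enorm (v h)) A0 ->
  sums_le (fun h => weighted p v h ^+ 2) (Ap ^+ 2) ->
  sums_le (fun l => znorm l * enorm (w l)) B1 ->
  sums_le (fun l => weighted (p + 1) w l ^+ 2) (Bp ^+ 2) ->
  (hnorm p (calP v w) <= (amp * 2 `^ p * (Ap * B1 + A0 * Bp))%:E)%E.
Proof.
move=> p0 Ap0 Bp0 vA0 vAp wB1 wBp; set c := amp * _.
have c0 : 0 <= c by rewrite mulr_ge0 ?mode_amp_ge0 ?powR_ge0.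
have A00 : 0 <= A0 by have := vA0 [::] isT; rewrite big_nil.
have B10 : 0 <= B1 by have := wB1 [::] isT; rewrite big_nil.
apply: hnorm_le => [|s us _]; first by rewrite mulr_ge0 // addr_ge0 // mulr_ge0.
pose adv_N N k := znorm k `^ p * enorm (advection_partial N v w k).
have advN N : \sum_(k <- s) adv_N N k ^+ 2 <= (c * (Ap * B1 + A0 * Bp)) ^+ 2.
  pose F := exhaust (T := index) N.
  pose x k := \sum_(h <- F) weighted p v h * (znorm (k - h) * enorm (w (k - h))).
  pose y k := \sum_(h <- F) enorm (v h) * weighted (p + 1) w (k - h).
  have xy k : adv_N N k <= c * (x k + y k).
    apply: (@le_trans _ _ (znorm k `^ p * (amp *
        \sum_(h <- F) enorm (v h) * (znorm (k - h) * enorm (w (k - h)))))).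
      by rewrite ler_wpM2l ?powR_ge0 // enorm_advection_partial.
    rewrite mulrCA /c -mulrA ler_wpM2l ?mode_amp_ge0 // -big_split /= !mulr_sumr.
    apply: ler_sum => h _; set e := enorm (v h); set f := znorm _ * enorm _.
    have ef : 0 <= e * f by rewrite !mulr_ge0 ?enorm_ge0.
    apply: le_trans (ler_wpM2r ef (znorm_powR_split k h (ltW p0))) _.
    rewrite weightedS ?gt_eqF ?addr_gt0 // -/f /weighted -/e.
    by rewrite le_eqVlt; apply/orP; left; apply/eqP; ring.
  have adv0 k : 0 <= adv_N N k by rewrite mulr_ge0 ?powR_ge0 ?enorm_ge0.
  apply: (@le_trans _ _ (\sum_(k <- s) (c * (x k + y k)) ^+ 2)).
    by apply: ler_sum => k _; rewrite lerXn2r ?nnegrE // (le_trans (adv0 k)).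
  under eq_bigr do rewrite exprMn.
  rewrite -mulr_sumr [leRHS]exprMn ler_wpM2l ?sqr_ge0 //.
  apply: sum_Minkowski_le; rewrite ?mulr_ge0 //.
    apply: (convolution_l2_l1 (b := fun l => znorm l * enorm (w l))) => //.
      exact: exhaust_uniq.
    by move=> l; rewrite mulr_ge0 ?enorm_ge0.
  apply: (convolution_l1_l2 (a := fun h => enorm (v h))) => //.
    exact: exhaust_uniq.
  by move=> h; exact: enorm_ge0.
have cvgN : \sum_(k <- s) adv_N N k ^+ 2 @[N --> \oo] -->
    \sum_(k <- s) weighted p (advection v w) k ^+ 2.
  apply: cvg_sum_seq => k; rewrite exprMn; under eq_fun do rewrite exprMn.
  by apply: cvgM; [exact: cvg_cst | exact: enorm_advection_cvg vA0 wB1].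
apply: (@le_trans _ _ (\sum_(k <- s) weighted p (advection v w) k ^+ 2)).
  apply: ler_sum => k _; rewrite lerXn2r ?nnegrE ?weighted_ge0 //.
  by rewrite ler_wpM2l ?powR_ge0 // enorm_leray.
by apply: (cvgr_to_le cvgN); near=> N; exact: advN.
Unshelve. all: by end_near. Qed.

(** Cauchy-Schwarz with the weight |k|^(-n), whose squares sum to zeta_2n. *)
Lemma sums_le_weighted_zeta (n : R) (g u : index -> R) (X : R) :
  (0 < d)%N -> d%:R / 2 < n -> 0 <= X ->
  (forall k, g k <= (znorm k `^ n)^-1 * u k) ->
  sums_le (fun k => u k ^+ 2) (X ^+ 2) ->
  sums_le g (Num.sqrt (zeta d (2 * n)) * X).
Proof.
move=> d0 dn X0 gu uX s us.
apply: le_trans (ler_sum _ (fun k _ => gu k)) _.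
apply: sum_CauchySchwarz_le => //; last exact: uX.
rewrite sqr_sqrtr; first exact: sums_le_zeta.
by have := sums_le_zeta d0 dn (s := [::]) isT; rewrite big_nil.
Qed.

Lemma inv_weight_le m (v : coefs R d) k : v 0 = 0 ->
  enorm (v k) <= (znorm k `^ m)^-1 * weighted m v k.
Proof.
move=> v0; have [->|k0] := eqVneq k 0.
  by rewrite v0 enorm0 mulr_ge0 ?invr_ge0 ?powR_ge0 ?weighted_ge0.
rewrite /weighted mulKf // gt_eqF // powR_gt0 // (lt_le_trans _ (znorm_ge1 k0)) //.
Qed.

Lemma inv_weightS_le m (v : coefs R d) k : m + 1 != 0 ->
  znorm k * enorm (v k) <= (znorm k `^ m)^-1 * weighted (m + 1) v k.
Proof.
move=> m1; have [->|k0] := eqVneq k 0.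
  by rewrite znorm0 mul0r mulr_ge0 ?invr_ge0 ?powR_ge0 ?weighted_ge0.
rewrite weightedS // mulKf // gt_eqF // powR_gt0 // (lt_le_trans _ (znorm_ge1 k0)) //.
Qed.

Lemma Kplus_admissible (p n : R) : (0 < d)%N -> d%:R / 2 < n -> n <= p ->
  admissible d p n (Kplus d p n).
Proof.
move=> d0 dn np v w [_ _ v0 vp] [_ _ _ wp].
have n0 : 0 < n by apply: le_lt_trans dn; rewrite divr_ge0.
have p0 : 0 < p by apply: lt_le_trans np.
have n1 : 0 < n + 1 by rewrite addr_gt0.
have p1 : 0 < p + 1 by rewrite addr_gt0.
have vn : (hnorm n v < +oo)%E by apply: le_lt_trans vp; exact: hnorm_mono.
have wn : (hnorm (n + 1) w < +oo)%E by apply: le_lt_trans wp; apply: hnorm_mono; rewrite lerD2r.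
have [Vp [Vp0 -> vVp]] := hnorm_real (lt0r_neq0 p0) vp.
have [Vn [Vn0 -> vVn]] := hnorm_real (lt0r_neq0 n0) vn.
have [Wp [Wp0 -> wWp]] := hnorm_real (lt0r_neq0 p1) wp.
have [Wn [Wn0 -> wWn]] := hnorm_real (lt0r_neq0 n1) wn.
have vA := sums_le_weighted_zeta d0 dn Vn0 (fun k => inv_weight_le n k v0) vVn.
have wB := sums_le_weighted_zeta d0 dn Wn0 (fun k => inv_weightS_le w k (lt0r_neq0 n1)) wWn.
apply: le_trans (hnorm_calP_le p0 Vp0 Wp0 vA vVp wB wWp) _.
have -> : (Vp%:E * Wn%:E + Vn%:E * Wp%:E)%E = (Vp * Wn + Vn * Wp)%:E by [].
rewrite -EFinM lee_fin /Kplus -/amp.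
rewrite powRD ?pnatr_eq0 ?implybT // powRr1 // le_eqVlt; apply/orP; left; apply/eqP.
by rewrite /mode_amp; field; rewrite gt_eqF // powR_gt0 // mulr_gt0 ?pi_gt0.
Qed.

End WeightedNorms.

(** * Sharp constant and asymptotics *)

Section SharpConstant.
Context {R : realType} {d : nat}.
Local Notation index := 'rV[int]_d.
Local Notation amp := (@mode_amp R d).

Lemma sums_le_finite_support (T : eqType) (f : T -> R) (t : seq T) :
  (forall i, 0 <= f i) -> (forall i, i \notin t -> f i = 0) ->
  sums_le f (\sum_(i <- t) f i).
Proof.
move=> f0 ft s us; rewrite (bigID (mem t)) /= [X in _ + X]big1 // addr0.
rewrite -big_filter; apply: ler_sum_subset => //; first exact: filter_uniq.
by move=> i; rewrite mem_filter => /andP[].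
Qed.

(** The field with coefficients e_2 at the frequencies e_1 and -e_1: a multiple
    of cos(x_1) e_2, which is divergence-free because the two directions are
    orthogonal. *)
Lemma exists_in_H : (2 <= d)%N -> exists v : coefs R d,
  forall m, m != 0 -> in_H m v /\ (0 < hnorm m v)%E.
Proof.
case: d => [|[|d']] // _.
pose i0 : 'I_d'.+2 := ord0; pose i1 : 'I_d'.+2 := lift ord0 ord0.
pose k0 : 'rV[int]_d'.+2 := delta_mx ord0 i0.
pose u : 'rV[R[i]]_d'.+2 := delta_mx ord0 i1.
pose v : coefs R d'.+2 := fun k => if (k == k0) || (k == - k0) then u else 0.
have k00 : k0 != 0.
  by apply/eqP => /rowP /(_ i0); rewrite !mxE !eqxx.
have k00N : 0 != - k0 by rewrite eq_sym oppr_eq0.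
have v0 : v 0 = 0 by rewrite /v eq_sym (negbTE k00) (negbTE k00N).
have eu : enorm u = 1.
  apply: enorm_eq_of_sqr => //; rewrite enorm_sqr (bigD1 i1) //= big1 => [|r ri].
    by rewrite mxE !eqxx [Normc.normc _]Normc.normc1 addr0.
  by rewrite mxE (negbTE ri) andbF [Normc.normc _]Normc.normc0 expr0n.
have growth k : enorm (v k) <= 1.
  by rewrite /v; case: ifP => _; rewrite ?eu ?enorm0.
have real k : v k = conjv (v (- k)).
  rewrite /v !eqr_oppLR opprK orbC.
  case: ifP => _; apply/rowP => r; rewrite !mxE ?conjc0 //.
  by case: (_ && _); rewrite /= oppr0.
have solenoidal k : cdot (zvec k) (v k) = 0.
  rewrite /v /cdot; case: ifP => [hk|_]; last by apply: big1 => r _; rewrite [X in _ * X]mxE mulr0.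
  apply: big1 => r _; rewrite !mxE.
  have [->|_] := eqVneq r i1; last by rewrite andbF mulr0.
  by case/orP: hk => /eqP ->; rewrite !mxE /= ?oppr0 mul0r.
exists v => m m0.
have fin : (hnorm m v < +oo)%E.
  pose f (k : 'rV[int]_d'.+2) := weighted m v k ^+ 2.
  have f0 k : 0 <= f k by exact: sqr_ge0.
  (* Adding 1 to the sum S of squares makes X^2 >= S without a root. *)
  pose X := 1 + \sum_(k <- [:: k0; - k0]) f k.
  have S0 : 0 <= \sum_(k <- [:: k0; - k0]) f k by exact: sumr_ge0.
  apply: (@le_lt_trans _ _ X%:E); last by rewrite ltry.
  apply: hnorm_le => [|s us _]; first by rewrite addr_ge0.
  apply: (@le_trans _ _ (\sum_(k <- [:: k0; - k0]) f k)).
    apply: sums_le_finite_support => // k; rewrite !inE => /negbTE hk.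
    by rewrite /f /weighted /v hk enorm0 mulr0 expr0n.
  rewrite /X; set S := \sum_(_ <- _) _ in S0 *; nra.
split.
  split=> //; split=> //; exists 1, 0%N => k.
  by rewrite expr0 mulr1.
have [X [X0 -> Xs]] := hnorm_real m0 fin.
rewrite lte_fin lt_def X0 andbT; apply/eqP => Xe.
have := Xs [:: k0] isT; rewrite big_seq1 Xe expr0n /= leNgt => /negP; apply.
rewrite exprn_gt0 // /weighted /v eqxx /= eu mulr1 powR_gt0 //.
exact: lt_le_trans (znorm_ge1 k00).
Qed.

Lemma hnorm_rhs_real (p n : R) (v w : coefs R d) :
  0 < n -> n <= p -> in_H p v -> in_H (p + 1) w ->
  exists2 Y : R, 0 <= Y &
    (hnorm p v * hnorm (n + 1) w + hnorm n v * hnorm (p + 1) w)%E = Y%:E.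
Proof.
move=> n0 np [_ _ _ vp] [_ _ _ wp].
have p0 : 0 < p by apply: lt_le_trans np.
have vn : (hnorm n v < +oo)%E by apply: le_lt_trans vp; exact: hnorm_mono.
have wn : (hnorm (n + 1) w < +oo)%E.
  by apply: le_lt_trans wp; apply: hnorm_mono; rewrite lerD2r.
have n1 : n + 1 != 0 by rewrite gt_eqF // addr_gt0.
have p1 : p + 1 != 0 by rewrite gt_eqF // addr_gt0.
have [Vp [Vp0 -> _]] := hnorm_real (lt0r_neq0 p0) vp.
have [Vn [Vn0 -> _]] := hnorm_real (lt0r_neq0 n0) vn.
have [Wp [Wp0 -> _]] := hnorm_real p1 wp.
have [Wn [Wn0 -> _]] := hnorm_real n1 wn.
by exists (Vp * Wn + Vn * Wp) => //; rewrite addr_ge0 // mulr_ge0.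
Qed.

(** Test the inequality on a field for which the right-hand side without the
    constant is positive. *)
Lemma admissible_ge0 (p n K : R) :
  (2 <= d)%N -> 0 < n -> n <= p -> admissible d p n K -> 0 <= K.
Proof.
move=> d2 n0 np adm; have p0 : 0 < p by apply: lt_le_trans np.
have [v vH] := exists_in_H d2.
have n1 : n + 1 != 0 by rewrite gt_eqF // addr_gt0.
have p1 : p + 1 != 0 by rewrite gt_eqF // addr_gt0.
have [vp vp0] := vH p (lt0r_neq0 p0).
have [wp wp0] := vH (p + 1) p1.
have [_ vn0] := vH n (lt0r_neq0 n0).
have [_ wn0] := vH (n + 1) n1.
have := adm v v vp wp.
have [Y Y0 eY] := hnorm_rhs_real n0 np vp wp.
have Yp : 0 < Y.
  by rewrite -lte_fin -eY adde_gt0 // mule_gt0.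
rewrite eY -EFinM => h.
have : (0 <= (2^-1 * K * Y)%:E)%E by apply: le_trans h; exact: sqrte_ge0.
by rewrite lee_fin pmulr_lge0 // pmulr_rge0 // invr_gt0.
Qed.

(** The sharp constant is the infimum of the admissible ones.  It is admissible
    itself because, for fixed v and w, the inequality is a closed condition on
    the constant. *)
Lemma exists_sharp_constant (p n K0 : R) :
  (2 <= d)%N -> 0 < n -> n <= p -> admissible d p n K0 ->
  exists2 K : R, is_sharp_constant d p n K & K <= K0.
Proof.
move=> d2 n0 np adm0; pose S := [set K : R | admissible d p n K].
have lbS : lbound S 0 by move=> K adm; exact: admissible_ge0 adm.
have hlb : has_lbound S by exists 0.
exists (inf S); last exact: ge_inf.
split; last by move=> K adm; exact: ge_inf.
move=> v w vH wH; have [Y Y0 eY] := hnorm_rhs_real n0 np vH wH.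
have bound K : admissible d p n K -> (hnorm p (calP v w) <= (2^-1 * K * Y)%:E)%E.
  by move=> adm; have := adm v w vH wH; rewrite eY -EFinM.
have Pfin : hnorm p (calP v w) \is a fin_num.
  by rewrite ge0_fin_numE ?sqrte_ge0 // (le_lt_trans (bound _ adm0)) // ltry.
rewrite eY -EFinM -(fineK Pfin) lee_fin; set Z := fine _.
have boundZ K : admissible d p n K -> Z <= 2^-1 * K * Y.
  by move=> adm; rewrite -lee_fin /Z fineK //; exact: bound.
move: Y0; rewrite le_eqVlt => /predU1P[Ye|Yp].
  by have := boundZ _ adm0; rewrite -Ye !mulr0.
have : Z / Y * 2 <= inf S.
  apply: lb_le_inf; first by exists K0.
  by move=> K /boundZ; rewrite -ler_pdivlMr // ler_pdivrMr // [K / 2]mulrC.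
by rewrite -ler_pdivlMr // ler_pdivrMr // [inf S / 2]mulrC.
Qed.

End SharpConstant.

Lemma cvg_inv_pinfty (R : realType) : (p : R)^-1 @[p --> +oo] --> (0 : R).
Proof.
apply/cvgrPdist_le => e e0; near=> p.
have pe : e^-1 <= p by near: p; apply: nbhs_pinfty_ge; exact: num_real.
have p0 : 0 < p by apply: lt_le_trans pe; rewrite invr_gt0.
by rewrite sub0r normrN gtr0_norm ?invr_gt0 // -[leRHS]invrK lef_pV2 ?posrE ?invr_gt0.
Unshelve. all: by end_near. Qed.

(** For p > 0 the expression equals a exp(ln c / p). *)
Lemma cvg_root_powR (R : realType) (a c : R) : 0 < a -> 0 < c ->
  (a `^ p * c) `^ p^-1 @[p --> +oo] --> a.
Proof.
move=> a0 c0.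
have h : a * expR (p^-1 * ln c) @[p --> +oo] --> a.
  rewrite -[X in _ --> X]mulr1 -[X in _ --> a * X]expR0 -(mul0r (ln c)).
  apply: cvgM; first exact: cvg_cst.
  apply: (cvg_comp (fun p : R => p^-1 * ln c) expR); last exact: continuous_expR.
  by apply: cvgM; [exact: cvg_inv_pinfty | exact: cvg_cst].
apply: cvg_trans h; apply: near_eq_cvg; near=> p.
have p0 : 0 < p by near: p; apply: nbhs_pinfty_gt; exact: num_real.
rewrite powRM ?powR_ge0 ?(ltW c0) // -powRrM divff ?gt_eqF // powRr1 ?(ltW a0) //.
by rewrite /powR gt_eqF.
Unshelve. all: by end_near. Qed.

Unset Implicit Arguments.

Theorem corollary3p4 (R : realType) (d : nat) (n : R)
    (hd : (2 <= d)%N) (hn : d%:R / 2 < n) :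
  (forall p : R, n <= p ->
     exists2 K : R, is_sharp_constant d p n K & K <= Kplus d p n)
  /\ (Kplus d p n `^ p^-1 @[p --> +oo] --> (2 : R)).
Proof.
have d0 : (0 < d)%N by apply: leq_trans hd.
have n0 : 0 < n by apply: le_lt_trans hn; rewrite divr_ge0.
split=> [p np|].
  exact: exists_sharp_constant hd n0 np (Kplus_admissible d0 hn np).
(* One of the p + 1 factors 2 goes into the constant, leaving 2^p c. *)
pose c : R := 2 * (mode_amp (d := d) * Num.sqrt (zeta d (2 * n))).
have c0 : 0 < c.
  rewrite !mulr_gt0 ?mode_amp_gt0 // sqrtr_gt0 zeta_gt0 //.
  by rewrite -ltr_pdivrMl // mulrC.
have -> : (fun p => Kplus d p n `^ p^-1) = (fun p => (2 `^ p * c) `^ p^-1).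
  apply/funext => p; congr (_ `^ _); rewrite /Kplus powRD ?pnatr_eq0 ?implybT //.
  by rewrite powRr1 // !mulrA.
exact: cvg_root_powR.
Qed.
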